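(* In the setting below (with $M\ge2$ fixed), there exists a function $g$ defined for small $\delta>0$ such that $L(D_{\mathcal N,0}+\delta)\le g(\delta)$ for all sufficiently small $\delta>0$, and $$\lim_{\delta\downarrow0}\frac{g(\delta)}{\frac M2\log\frac1\delta}=1.$$
   Context: Let $X$ be a real random variable with a density, finite variance $\sigma_X^2>0$ and finite differential entropy (natural logs throughout). Fix an integer $M\ge2$ and $\sigma_W^2>0$; let $W_1,\dots,W_M$ be i.i.d. $\mathcal N(0,\sigma_W^2)$ independent of $X$, $Y_i=X+W_i$, and $D_{\mathcal N,0}=\frac{\sigma_X^2\sigma_W^2}{M\sigma_X^2+\sigma_W^2}$. Consider $n$ i.i.d. copies. $R_X^{\mathrm{CEO}}(D)$ is the infimum of sum-rates $R_1+\dots+R_M$ for which, for every $\varepsilon>0$ and all large $n$, there exist encoders $i$ mapping $Y_i^n$ to indices in $\{1,\dots,\lfloor e^{nR_i}\rfloor\}$ and a joint decoder outputting $\hat X^n$ with $\frac1n\sum_t\mathbb E[(X_t-\hat X_t)^2]\le D+\varepsilon$; $R_X^{\mathrm R}(D)$ is the analogous quantity with a single encoder observing all $(Y_1^n,\dots,Y_M^n)$ at rate $R$. The rate loss is $L(D)=R_X^{\mathrm{CEO}}(D)-R_X^{\mathrm R}(D)$. *)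

(* Defs.v *)
From HB Require Import structures.
From mathcomp Require Import all_boot all_order all_algebra.
From mathcomp Require Import all_classical all_reals all_analysis.
Unset Printing Implicit Defensive.
Import Order.TTheory GRing.Theory Num.Theory.
Import numFieldNormedType.Exports.
Local Open Scope classical_set_scope.
Local Open Scope ring_scope.
Local Open Scope ereal_scope.

Fixpoint iter_int {T : Type} {R : realType} (I : (T -> \bar R) -> \bar R) (k : nat)
  : (k.-tuple T -> \bar R) -> \bar R :=
  match k return (k.-tuple T -> \bar R) -> \bar R with
  | 0 => fun F => F [tuple]
  | k'.+1 => fun F => I (fun x => iter_int I k' (fun v => F (cons_tuple x v)))
  end.
Arguments iter_int {T R} I k F.

Section CEO.
Variable R : realType.

Definition leb_int (F : R -> \bar R) : \bar R := \int[@lebesgue_measure R]_x F x.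

(* integral over R^n (n-fold iterated Lebesgue integral; nonnegative integrands) *)
Definition int_n (n : nat) := iter_int leb_int n.

Definition int_nM (n M : nat) := iter_int (int_n n) M.

Definition noise_pdf (sW2 : R) (w : R) : R := normal_pdf 0 (Num.sqrt sW2) w.

Definition joint_pdf (f : R -> R) (sW2 : R) (n M : nat)
  (x : n.-tuple R) (y : M.-tuple (n.-tuple R)) : R :=
  (\prod_(t < n) f (tnth x t)) *
  \prod_(i < M) \prod_(t < n) noise_pdf sW2 (tnth (tnth y i) t - tnth x t).

Definition sqerr (n : nat) (x xh : n.-tuple R) : R :=
  (n%:R)^-1 * \sum_(t < n) (tnth x t - tnth xh t) ^+ 2.

Definition exp_dist (f : R -> R) (sW2 : R) (n M : nat)
  (rec : M.-tuple (n.-tuple R) -> n.-tuple R) : \bar R :=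
  int_n n (fun x => int_nM n M (fun y =>
     (joint_pdf f sW2 n M x y * sqerr n x (rec y))%:E)).

Definition nidx (n : nat) (r : R) : nat := Num.truncn (expR (n%:R * r)).

Definition CEO_achievable (f : R -> R) (sW2 : R) (M : nat) (D : R)
  (r : 'I_M -> R) : Prop :=
  forall eps : R, (0 < eps)%R -> exists N : nat, forall n : nat, (N <= n)%N ->
    exists (enc : 'I_M -> n.-tuple R -> nat) (dec : ('I_M -> nat) -> n.-tuple R),
      (forall i, measurable_fun setT (enc i)) /\
      (forall i y, (enc i y < nidx n (r i))%N) /\
      exp_dist f sW2 n M (fun y => dec (fun i => enc i (tnth y i))) <= (D + eps)%:E.

Definition R_CEO (f : R -> R) (sW2 : R) (M : nat) (D : R) : \bar R :=
  ereal_inf [set (\sum_(i < M) r i)%:E | r in CEO_achievable f sW2 M D].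

Definition Rem_achievable (f : R -> R) (sW2 : R) (M : nat) (D : R) (r : R) : Prop :=
  forall eps : R, (0 < eps)%R -> exists N : nat, forall n : nat, (N <= n)%N ->
    exists (enc : M.-tuple (n.-tuple R) -> nat) (dec : nat -> n.-tuple R),
      measurable_fun setT enc /\
      (forall y, (enc y < nidx n r)%N) /\
      exp_dist f sW2 n M (fun y => dec (enc y)) <= (D + eps)%:E.

Definition R_R (f : R -> R) (sW2 : R) (M : nat) (D : R) : \bar R :=
  ereal_inf [set r%:E | r in Rem_achievable f sW2 M D].

Definition rate_loss (f : R -> R) (sW2 : R) (M : nat) (D : R) : \bar R :=
  R_CEO f sW2 M D - R_R f sW2 M D.

Definition meanX (f : R -> R) : R := \int[@lebesgue_measure R]_x (x * f x)%R.
Definition varX (f : R -> R) : R :=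
  \int[@lebesgue_measure R]_x ((x - meanX f) ^+ 2 * f x)%R.

Definition is_density (f : R -> R) : Prop :=
  measurable_fun setT f /\ (forall x, (0 <= f x)%R) /\
  \int[@lebesgue_measure R]_x (f x)%:E = 1.

Definition finite_variance (f : R -> R) : Prop :=
  \int[@lebesgue_measure R]_x ((x ^+ 2 * f x)%R)%:E < +oo.

(* finite differential entropy h(X) = - int f ln f  (with 0 ln 0 = 0) *)
Definition finite_entropy (f : R -> R) : Prop :=
  (@lebesgue_measure R).-integrable setT (fun x => (f x * ln (f x))%R%:E).

Definition D_N0 (f : R -> R) (sW2 : R) (M : nat) : R :=
  (varX f * sW2 / (M%:R * varX f + sW2))%R.

End CEO.

Arguments leb_int {R}.
Arguments int_n {R}.
Arguments int_nM {R}.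
Arguments noise_pdf {R}.
Arguments joint_pdf {R}.
Arguments sqerr {R}.
Arguments exp_dist {R}.
Arguments nidx {R}.
Arguments CEO_achievable {R}.
Arguments R_CEO {R}.
Arguments Rem_achievable {R}.
Arguments R_R {R}.
Arguments rate_loss {R}.
Arguments meanX {R}.
Arguments varX {R}.
Arguments is_density {R}.
Arguments finite_variance {R}.
Arguments finite_entropy {R}.
Arguments D_N0 {R}.

(* Main.v *)
Require Import Defs.
From HB Require Import structures.
From mathcomp Require Import all_boot all_order all_algebra.
From mathcomp Require Import all_classical all_reals all_analysis.
From mathcomp Require Import measurable_realfun zify ring lra.
Import Order.TTheory GRing.Theory Num.Theory.
Import numFieldNormedType.Exports.
Local Open Scope classical_set_scope.
Local Open Scope ring_scope.

(** Since a rate is nonnegative, [rate_loss <= R_CEO], so it is enough to achieve the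
distortion [D_N0 + d] at sum-rate [(M/2) ln (1/d) + O(1)]. Each encoder quantizes its
samples on a grid of step [dl], with [dl^2] of order [d], and the decoder applies the
linear estimator [m + g * sum_i (Y_i - m)] that attains [D_N0] to the quantized values.
Quantization adds only [O(dl^2)] provided that the cross term between estimation error and
quantization error is [O(dl^2)] too. It is not for a fixed grid, but it is on average
over the [L] grids shifted by [j * dl / L], [L >= 1/dl], so some shift works.

For the rate, an encoder only describes the words [k] of grid indices with
[sum_t |k_t| < n * s], where [s = O(1/dl)]. As [exp (- dl * |k|)] has a sum of order
[1/dl] over all integers [k], there are at most [(O(1)/dl)^n] such words, that is a rate of
[ln (1/dl) + O(1)]. By Chebyshev's inequality other words are rare; the decoder then answers
[0], and the resulting error [E (X_t^2; overload)] vanishes as [n] grows, since [X^2] is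
integrable.

No measurability of the distortion is needed: the integral of a nonnegative function is
always monotone and superadditive, which bounds the sum over [j] of the distortions by the
expectation of an explicit combination of products of one-letter functions. *)

(** * Lower integrals and iterated integrals *)

(** These are the properties of the integral of nonnegative functions that survive without
    measurability, and they pass to iterated integrals. *)
Record superlinear {T : Type} {R : realType} (I : (T -> \bar R) -> \bar R) : Prop :=
  Superlinear {
    sl_ge0 : forall F, (forall x, 0 <= F x)%E -> (0 <= I F)%E;
    sl_le : forall F G, (forall x, 0 <= F x)%E -> (forall x, F x <= G x)%E ->
      (I F <= I G)%E;
    sl_add : forall F G, (forall x, 0 <= F x)%E -> (forall x, 0 <= G x)%E ->
      (I F + I G <= I (fun x => F x + G x))%E }.

Section LowerIntegral.
Import HBNNSimple.

(* The integral of a nonnegative function is a supremum over the simple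
   functions below it, so the next two bounds need no measurability. *)
Lemma ge0_integral_mono d (T : measurableType d) (R : realType)
  (mu : {measure set T -> \bar R}) (F G : T -> \bar R) :
  (forall x, 0 <= F x)%E -> (forall x, F x <= G x)%E ->
  (\int[mu]_x F x <= \int[mu]_x G x)%E.
Proof.
move=> F0 FG.
have G0 x : (0 <= G x)%E by exact: le_trans (F0 x) (FG x).
rewrite !ge0_integralTE//; apply: ge_ereal_sup => _ [h /= hF <-].
by apply: ereal_sup_ubound; exists h => //= x; exact: le_trans (hF x) (FG x).
Qed.

Lemma ge0_integral_superadditive d (T : measurableType d) (R : realType)
  (mu : {measure set T -> \bar R}) (F G : T -> \bar R) :
  (forall x, 0 <= F x)%E -> (forall x, 0 <= G x)%E ->
  (\int[mu]_x F x + \int[mu]_x G x <= \int[mu]_x (F x + G x))%E.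
Proof.
move=> F0 G0.
have FG0 x : (0 <= F x + G x)%E by exact: adde_ge0.
set I := (X in (X + _ <= _)%E); set J := (X in (_ + X <= _)%E).
set K := (X in (_ <= X)%E).
(* Once [K] is finite, everything below it is finite too, which the subtractions further down
   require. *)
have [Koo|Kfin] := eqVneq K +oo%E; first by rewrite Koo leey.
have Klt : (K < +oo)%E by rewrite lt_neqAle Kfin leey.
have below (f g : {nnsfun T >-> R}) : (forall x, (f x)%:E <= F x)%E ->
    (forall x, (g x)%:E <= G x)%E ->
    (sintegral mu f + sintegral mu g <= K)%E.
  move=> fF gG; rewrite -sintegralD /K ge0_integralTE//.
  apply: ereal_sup_ubound; exists (add_nnsfun f g) => //= x.
  by rewrite EFinD leeD.
have IK : (I <= K)%E by apply: ge0_integral_mono => // x; rewrite leeDl.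
have JK : (J <= K)%E by apply: ge0_integral_mono => // x; rewrite leeDr.
have If : I \is a fin_num.
  by rewrite ge0_fin_numE ?(le_lt_trans IK)//; exact: integral_ge0.
have Jf : J \is a fin_num.
  by rewrite ge0_fin_numE ?(le_lt_trans JK)//; exact: integral_ge0.
have sfin (f : {nnsfun T >-> R}) : (forall x, (f x)%:E <= F x)%E ->
    sintegral mu f \is a fin_num.
  move=> fF; rewrite ge0_fin_numE ?sintegral_ge0//.
  apply: (le_lt_trans _ Klt); apply: le_trans IK.
  by rewrite /I ge0_integralTE//; apply: ereal_sup_ubound; exists f.
(* The two suprema are taken one after the other, each time with the other summand moved to the
   right-hand side. *)
rewrite -leeBrDr// /I ge0_integralTE//.
apply: ge_ereal_sup => _ [f /= fF <-]; rewrite leeBrDr//.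
rewrite addeC -leeBrDr ?sfin// /J ge0_integralTE//.
apply: ge_ereal_sup => _ [g /= gG <-].
by rewrite leeBrDr ?sfin// addeC below.
Qed.

End LowerIntegral.

Lemma leb_int_superlinear (R : realType) : superlinear (@leb_int R).
Proof.
split.
- by move=> F F0; apply: integral_ge0.
- exact: (ge0_integral_mono _ _ _ lebesgue_measure).
- exact: (ge0_integral_superadditive _ _ _ lebesgue_measure).
Qed.

Lemma iter_int_superlinear (T : Type) (R : realType) (I : (T -> \bar R) -> \bar R)
  (k : nat) : superlinear I -> superlinear (iter_int I k).
Proof.
move=> sI; elim: k => [|k IH]; first by split => //=.
split => /=.
- by move=> F F0; apply: (sl_ge0 _ sI) => x; exact: (sl_ge0 _ IH).
- move=> F G F0 FG; apply: (sl_le _ sI) => x; first exact: (sl_ge0 _ IH).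
  exact: (sl_le _ IH).
- move=> F G F0 G0; apply: le_trans (sl_add _ sI _ _ _ _) _.
  + by move=> x; exact: (sl_ge0 _ IH).
  + by move=> x; exact: (sl_ge0 _ IH).
  apply: (sl_le _ sI) => x; last exact: (sl_add _ IH).
  by apply: adde_ge0; exact: (sl_ge0 _ IH).
Qed.

Lemma superlinear_sum (T : Type) (R : realType) (I : (T -> \bar R) -> \bar R)
  (J : Type) (r : seq J) (F : J -> T -> \bar R) :
  superlinear I -> (forall j x, 0 <= F j x)%E ->
  (\sum_(j <- r) I (F j) <= I (fun x => \sum_(j <- r) F j x))%E.
Proof.
move=> sI F0; elim: r => [|j r IH].
  by rewrite big_nil; apply: (sl_ge0 _ sI) => x; rewrite big_nil.
rewrite big_cons; apply: (@le_trans _ _ (I (F j) + I (fun x => \sum_(j <- r) F j x))%E).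
  exact: leeD.
apply: le_trans (sl_add _ sI _ _ _ _) _ => //.
  by move=> x; apply: sume_ge0.
by apply: (sl_le _ sI) => x; rewrite ?big_cons//; apply: adde_ge0 => //; apply: sume_ge0.
Qed.

(* [P F v] reads: [F] is integrable with integral [v]. *)
Record linear_rel {T : Type} {R : realType} (I : (T -> \bar R) -> \bar R)
  (P : (T -> R) -> R -> Prop) : Prop := LinearRel {
    lr_val : forall F v, P F v -> I (fun x => (F x)%:E) = v%:E;
    lr_add : forall F G v w, P F v -> P G w -> P (fun x => F x + G x) (v + w);
    lr_scale : forall c F v, P F v -> P (fun x => c * F x) (c * v) }.

Definition leb_rel {R : realType} (F : R -> R) (v : R) : Prop :=
  (@lebesgue_measure R).-integrable setT (fun x => (F x)%:E) /\
  (\int[@lebesgue_measure R]_x (F x)%:E = v%:E)%E.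

(** The witness [g] is the inner integral, required at every point and not only almost everywhere,
    so iterated integrals are evaluated without Fubini. *)
Fixpoint iter_rel {T : Type} {R : realType} (P : (T -> R) -> R -> Prop) (k : nat) :
  (k.-tuple T -> R) -> R -> Prop :=
  match k return (k.-tuple T -> R) -> R -> Prop with
  | 0 => fun F v => F [tuple] = v
  | k'.+1 => fun F v => exists2 g : T -> R,
      forall x, iter_rel P k' (fun t => F (cons_tuple x t)) (g x) & P g v
  end.

Lemma leb_rel_linear (R : realType) : linear_rel (@leb_int R) leb_rel.
Proof.
split.
- by move=> F v [].
- move=> F G v w [iF eF] [iG eG]; split.
    by under eq_fun do rewrite EFinD; exact: integrableD.
  under eq_integral do rewrite EFinD.
  by rewrite integralD// eF eG.
- move=> c F v [iF eF]; split.
    by under eq_fun do rewrite EFinM; exact: integrableZl.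
  under eq_integral do rewrite EFinM.
  by rewrite integralZl// eF.
Qed.

Lemma iter_rel_linear (T : Type) (R : realType) (I : (T -> \bar R) -> \bar R)
  (P : (T -> R) -> R -> Prop) (k : nat) :
  linear_rel I P -> linear_rel (iter_int I k) (iter_rel P k).
Proof.
move=> lP; elim: k => [|k IH].
  by split => /= [F v ->//|F G v w -> ->//|c F v ->].
split=> /=.
- move=> F v [g gF gv]; rewrite -(lr_val _ _ lP _ _ gv); congr I.
  by apply/funext => x; exact: (lr_val _ _ IH).
- move=> F G v w [g gF gv] [h hG hw]; exists (fun x => g x + h x).
    by move=> x; exact: (lr_add _ _ IH).
  exact: (lr_add _ _ lP).
- move=> c F v [g gF gv]; exists (fun x => c * g x).
    by move=> x; exact: (lr_scale _ _ IH).
  exact: (lr_scale _ _ lP).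
Qed.

(** This is independence of the coordinates: the first factor is a scalar for the inner integral,
    and the rest follows by induction. *)
Lemma iter_rel_prod (T : Type) (R : realType) (I : (T -> \bar R) -> \bar R)
  (P : (T -> R) -> R -> Prop) (k : nat) (h : 'I_k -> T -> R) (c : 'I_k -> R) :
  linear_rel I P -> (forall t, P (h t) (c t)) ->
  iter_rel P k (fun v => \prod_(t < k) h t (tnth v t)) (\prod_(t < k) c t).
Proof.
move=> lP; elim: k h c => [|k IH] h c hc /=; first by rewrite !big_ord0.
exists (fun x => (\prod_(t < k) c (lift ord0 t)) * h ord0 x).
  move=> x; rewrite mulrC.
  suff -> : (fun t => \prod_(i < k.+1) h i (tnth (cons_tuple x t) i)) =
    (fun t => h ord0 x * \prod_(i < k) h (lift ord0 i) (tnth t i)).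
    apply: (lr_scale _ _ (iter_rel_linear _ _ _ _ k lP)).
    exact: (IH (fun i => h (lift ord0 i)) (fun i => c (lift ord0 i)) (fun i => hc _)).
  apply/funext => t; rewrite big_ord_recl; congr (_ * _).
  by apply: eq_bigr => i _; rewrite tnthS.
by rewrite big_ord_recl mulrC; exact: (lr_scale _ _ lP).
Qed.

(** * Expectations under the joint law *)

Section JointRel.
Context {R : realType}.
Variables (f : R -> R) (sW2 : R) (n M : nat).

Definition noise (x : n.-tuple R) (y : M.-tuple (n.-tuple R)) (p : 'I_M * 'I_n) : R :=
  tnth (tnth y p.1) p.2 - tnth x p.2.

Definition joint_int (F : n.-tuple R -> M.-tuple (n.-tuple R) -> \bar R) : \bar R :=
  int_n n (fun x => int_nM n M (F x)).

(* [source_rel b v] reads [E b(X) = v], [noise_rel a v] reads [E a(W) = v] and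
   [joint_rel F v] reads [E F(X^n, Y_1^n, ..., Y_M^n) = v], integrability included. *)
Definition source_rel (b : R -> R) (v : R) : Prop := leb_rel (fun x => f x * b x) v.

Definition noise_rel (a : R -> R) (v : R) : Prop :=
  forall x, leb_rel (fun y => noise_pdf sW2 (y - x) * a (y - x)) v.

Definition joint_rel (F : n.-tuple R -> M.-tuple (n.-tuple R) -> R) (v : R) : Prop :=
  exists2 g : n.-tuple R -> R,
    forall x, iter_rel (iter_rel leb_rel n) M (fun y => joint_pdf f sW2 n M x y * F x y) (g x)
    & iter_rel leb_rel n g v.

Lemma joint_int_le (F G : n.-tuple R -> M.-tuple (n.-tuple R) -> \bar R) :
  (forall x y, 0 <= F x y)%E -> (forall x y, F x y <= G x y)%E ->
  (joint_int F <= joint_int G)%E.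
Proof.
move=> F0 FG; rewrite /joint_int /int_nM /int_n.
have sn := iter_int_superlinear _ _ _ n (leb_int_superlinear R).
have sM := iter_int_superlinear _ _ _ M sn.
by apply: (sl_le _ sn) => x; [apply: (sl_ge0 _ sM)|apply: (sl_le _ sM)].
Qed.

Lemma joint_int_sum (J : Type) (r : seq J)
  (F : J -> n.-tuple R -> M.-tuple (n.-tuple R) -> \bar R) :
  (forall j x y, 0 <= F j x y)%E ->
  (\sum_(j <- r) joint_int (F j) <= joint_int (fun x y => \sum_(j <- r) F j x y))%E.
Proof.
move=> F0; rewrite /joint_int /int_nM /int_n.
have sn := iter_int_superlinear _ _ _ n (leb_int_superlinear R).
have sM := iter_int_superlinear _ _ _ M sn.
apply: le_trans (superlinear_sum _ _ _ _ _ _ sn _) _.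
  by move=> j x; apply: (sl_ge0 _ sM).
apply: (sl_le _ sn) => x; first by apply: sume_ge0 => j _; apply: (sl_ge0 _ sM).
exact: superlinear_sum.
Qed.

Let leb_n := iter_rel_linear _ _ _ _ n (leb_rel_linear R).
Let leb_nM := iter_rel_linear _ _ _ _ M leb_n.

Lemma joint_rel_val F v : joint_rel F v ->
  joint_int (fun x y => (joint_pdf f sW2 n M x y * F x y)%:E) = v%:E.
Proof.
move=> [g gF gv]; rewrite -(lr_val _ _ leb_n _ _ gv) /joint_int /int_nM /int_n.
by congr iter_int; apply/funext => x; exact: (lr_val _ _ leb_nM).
Qed.

Lemma joint_rel_ext F G v : joint_rel F v -> (forall x y, F x y = G x y) -> joint_rel G v.
Proof.
by move=> h FG; suff <- : F = G by []; apply/funext => x; apply/funext.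
Qed.

Lemma joint_relD F G v w : joint_rel F v -> joint_rel G w ->
  joint_rel (fun x y => F x y + G x y) (v + w).
Proof.
move=> [g gF gv] [h hG hw]; exists (fun x => g x + h x).
  move=> x; under eq_fun do rewrite mulrDr.
  exact: (lr_add _ _ leb_nM).
exact: (lr_add _ _ leb_n).
Qed.

Lemma joint_relZ c F v : joint_rel F v -> joint_rel (fun x y => c * F x y) (c * v).
Proof.
move=> [g gF gv]; exists (fun x => c * g x).
  move=> x; under eq_fun do rewrite mulrCA.
  exact: (lr_scale _ _ leb_nM).
exact: (lr_scale _ _ leb_n).
Qed.

(** As [noise_rel] holds for every shift, integrating out the observations leaves a constant that
    does not depend on the source word; the source letters then factor. *)
Lemma joint_rel_prod (b : 'I_n -> R -> R) (beta : 'I_n -> R)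
  (a : 'I_M * 'I_n -> R -> R) (alpha : 'I_M * 'I_n -> R) :
  (forall t, source_rel (b t) (beta t)) -> (forall p, noise_rel (a p) (alpha p)) ->
  joint_rel (fun x y => \prod_t b t (tnth x t) * \prod_p a p (noise x y p))
    (\prod_t beta t * \prod_p alpha p).
Proof.
move=> hb ha.
exists (fun x => (\prod_p alpha p) * \prod_t (f (tnth x t) * b t (tnth x t))).
  move=> x.
  (* [H i] gathers the factors of encoder [i], so that factorization applies first across encoders
     and then across time. *)
  pose H i (v : n.-tuple R) :=
    \prod_t (noise_pdf sW2 (tnth v t - tnth x t) * a (i, t) (tnth v t - tnth x t)).
  have hH i : iter_rel leb_rel n (H i) (\prod_t alpha (i, t)).
    apply: (iter_rel_prod _ _ _ _ n
      (fun t y => noise_pdf sW2 (y - tnth x t) * a (i, t) (y - tnth x t))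
      (fun t => alpha (i, t)) (leb_rel_linear R)) => t.
    exact: ha.
  have := lr_scale _ _ leb_nM (\prod_t (f (tnth x t) * b t (tnth x t))) _ _
    (iter_rel_prod _ _ _ _ M H _ leb_n hH).
  rewrite mulrC [in X in iter_rel _ _ _ X -> _]pair_bigA /=.
  rewrite (_ : \prod_p alpha (p.1, p.2) = \prod_p alpha p); last first.
    by apply: eq_bigr => -[].
  congr (iter_rel _ _ _ _); apply/funext => y.
  rewrite /joint_pdf /H /noise.
  rewrite [in RHS]mulrACA -big_split/=; congr (_ * _).
  rewrite pair_bigA pair_bigA -big_split/=.
  by apply: eq_bigr => -[].
rewrite [X in iter_rel _ _ _ X]mulrC; apply: (lr_scale _ _ leb_n).
exact: (iter_rel_prod _ _ _ _ n (fun t x => f x * b t x) beta (leb_rel_linear R)).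
Qed.

(** Functions of one or two letters become products over all letters with trivial factors elsewhere,
    the form that [joint_rel_prod] accepts. *)
Lemma prod_if1 (K : finType) (k0 : K) (F : K -> R) :
  \prod_k (if k == k0 then F k else 1) = F k0.
Proof. by rewrite -big_mkcond big_pred1_eq. Qed.

Lemma prod_if2 (K : finType) (k0 k1 : K) (F G : K -> R) : k1 != k0 ->
  \prod_k (if k == k0 then F k else if k == k1 then G k else 1) = F k0 * G k1.
Proof.
move=> k10; rewrite (bigD1 k0)//= eqxx; congr (_ * _).
rewrite (bigD1 k1)//= (negbTE k10) eqxx big1 ?mulr1// => k /andP[kk0 kk1].
by rewrite (negbTE kk0) (negbTE kk1).
Qed.

Hypothesis f1 : source_rel (fun=> 1) 1.
Hypothesis w1 : noise_rel (fun=> 1) 1.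

Lemma joint_rel_xw (t : 'I_n) (p : 'I_M * 'I_n) (b a : R -> R) (beta alpha : R) :
  source_rel b beta -> noise_rel a alpha ->
  joint_rel (fun x y => b (tnth x t) * a (noise x y p)) (beta * alpha).
Proof.
move=> hb ha.
have := joint_rel_prod (fun u => if u == t then b else fun=> 1)
  (fun u => if u == t then beta else 1)
  (fun q => if q == p then a else fun=> 1) (fun q => if q == p then alpha else 1).
rewrite !prod_if1 => h; apply: joint_rel_ext (h _ _) _ => [u|q|x y].
- by case: ifP.
- by case: ifP.
rewrite -[in RHS](prod_if1 _ t (fun u => b (tnth x u))).
rewrite -[in RHS](prod_if1 _ p (fun q => a (noise x y q))).
by congr (_ * _); apply: eq_bigr => u _; case: ifP.
Qed.

Lemma joint_rel_x (t : 'I_n) (b : R -> R) (beta : R) :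
  source_rel b beta -> joint_rel (fun x y => b (tnth x t)) beta.
Proof.
move=> hb.
have := joint_rel_prod (fun u => if u == t then b else fun=> 1)
  (fun u => if u == t then beta else 1) (fun=> fun=> 1) (fun=> 1).
rewrite prod_if1 big1_eq mulr1 => h; apply: joint_rel_ext (h _ _) _ => [u|q|x y] //.
  by case: ifP.
rewrite ?big1_eq mulr1.
rewrite -[in RHS](prod_if1 _ t (fun u => b (tnth x u))).
by apply: eq_bigr => u _; case: ifP.
Qed.

Lemma joint_rel_xx (t u : 'I_n) (b : R -> R) : u != t ->
  source_rel b 0 -> joint_rel (fun x y => b (tnth x t) * b (tnth x u)) 0.
Proof.
move=> ut hb.
have := joint_rel_prod
  (fun r => if r == t then b else if r == u then b else fun=> 1)
  (fun r => if r == t then 0 else if r == u then 0 else 1) (fun=> fun=> 1) (fun=> 1).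
rewrite prod_if2// !mul0r => h; apply: joint_rel_ext (h _ _) _ => [r|q|x y] //.
  by case: ifP => // _; case: ifP.
rewrite ?big1_eq mulr1.
rewrite -[in RHS](prod_if2 _ t u (fun r => b (tnth x r)) (fun r => b (tnth x r)))//.
by apply: eq_bigr => r _; case: ifP => // _; case: ifP.
Qed.

Lemma joint_rel_ww (p q : 'I_M * 'I_n) (a : R -> R) : q != p ->
  noise_rel a 0 -> joint_rel (fun x y => a (noise x y p) * a (noise x y q)) 0.
Proof.
move=> qp ha.
have := joint_rel_prod (fun=> fun=> 1) (fun=> 1)
  (fun r => if r == p then a else if r == q then a else fun=> 1)
  (fun r => if r == p then 0 else if r == q then 0 else 1).
rewrite prod_if2// !mul0r mulr0 => h; apply: joint_rel_ext (h _ _) _ => [r|r|x y] //.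
  by case: ifP => // _; case: ifP.
rewrite ?big1_eq mul1r.
rewrite -[in RHS](prod_if2 _ p q (fun r => a (noise x y r)) (fun r => a (noise x y r)))//.
by apply: eq_bigr => r _; case: ifP => // _; case: ifP.
Qed.

End JointRel.

(** * Moments of the Gaussian noise *)

Lemma leb_rel_le (R : realType) (F G : R -> R) (v w : R) :
  leb_rel F v -> leb_rel G w -> (forall x, F x <= G x) -> v <= w.
Proof.
move=> [iF eF] [iG eG] FG; rewrite -lee_fin -eF -eG.
by apply: le_integral => // x _; rewrite lee_fin.
Qed.

Lemma leb_rel_ext (R : realType) (F G : R -> R) (v : R) :
  leb_rel F v -> (forall x, F x = G x) -> leb_rel G v.
Proof. by move=> h FG; suff <- : F = G by []; apply/funext. Qed.

Lemma leb_rel_dominated (R : realType) (F G : R -> R) (w : R) :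
  leb_rel G w -> measurable_fun setT F -> (forall x, `|F x| <= G x) ->
  exists v, leb_rel F v.
Proof.
move=> [iG _] mF FG.
have iF : (@lebesgue_measure R).-integrable setT (fun x => (F x)%:E).
  apply: le_integrable iG => //; first exact/measurable_EFinP.
  move=> x _ /=; rewrite lee_fin (le_trans (FG x))//.
  exact: ler_norm.
exists (fine (\int[lebesgue_measure]_x (F x)%:E)); split => //.
by rewrite fineK//; exact: integrable_fin_num.
Qed.

Section Noise.
Context {R : realType}.
Variable sW2 : R.
Hypothesis sW2_gt0 : 0 < sW2.

Let sigma := Num.sqrt sW2.
Let sigma_gt0 : 0 < sigma. Proof. by rewrite sqrtr_gt0. Qed.
Let sigma_neq0 : sigma != 0. Proof. exact: lt0r_neq0. Qed.
Let sigma2 : sigma ^+ 2 = sW2. Proof. by rewrite sqr_sqrtr// ltW. Qed.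

Lemma normal_rel (m s : R) : leb_rel (normal_pdf m s) 1.
Proof. split; [exact: integrable_normal_pdf|exact: integral_normal_pdf]. Qed.

Lemma noise_pdf_ge0 (w : R) : 0 <= noise_pdf sW2 w.
Proof. exact: normal_pdf_ge0. Qed.

Lemma noise_pdfE (w : R) :
  noise_pdf sW2 w = normal_peak sigma * expR (- w ^+ 2 / (sW2 *+ 2)).
Proof. by rewrite /noise_pdf normal_pdfE//= /normal_fun subr0 sigma2. Qed.

Lemma measurable_noise_pdf : measurable_fun setT (noise_pdf sW2).
Proof. exact: measurable_normal_pdf. Qed.

Lemma noise_relD (a b : R -> R) (u v : R) : noise_rel sW2 a u -> noise_rel sW2 b v ->
  noise_rel sW2 (fun w => a w + b w) (u + v).
Proof.
move=> ha hb x; apply: leb_rel_ext (lr_add _ _ (leb_rel_linear R) _ _ _ _ (ha x) (hb x)) _.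
by move=> y; rewrite mulrDr.
Qed.

Lemma noise_relZ (c : R) (a : R -> R) (u : R) : noise_rel sW2 a u ->
  noise_rel sW2 (fun w => c * a w) (c * u).
Proof.
move=> ha x; apply: leb_rel_ext (lr_scale _ _ (leb_rel_linear R) c _ _ (ha x)) _.
by move=> y; rewrite mulrCA.
Qed.

Lemma noise_rel_ext (a b : R -> R) (u : R) : noise_rel sW2 a u -> a =1 b ->
  noise_rel sW2 b u.
Proof. by move=> h /funext <-. Qed.

(** Completing the square: tilting the noise density by [expR (t * w)] gives a multiple of the
    normal density with mean moved by [t * sW2]. *)
Lemma noise_rel_expR (t : R) :
  noise_rel sW2 (fun w => expR (t * w)) (expR (t ^+ 2 * sW2 / 2)).
Proof.
move=> x.
have := lr_scale _ _ (leb_rel_linear R) (expR (t ^+ 2 * sW2 / 2)) _ _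
  (normal_rel (x + t * sW2) sigma).
rewrite mulr1 => h; apply: leb_rel_ext h _ => y.
rewrite noise_pdfE normal_pdfE//= /normal_fun sigma2.
rewrite mulrCA -[RHS]mulrA -!expRD; congr (_ * expR _).
by field; rewrite gt_eqF.
Qed.

Lemma noise_rel1 : noise_rel sW2 (fun=> 1) 1.
Proof.
have := noise_rel_expR 0; rewrite expr0n mul0r mul0r expR0 => h.
by apply: noise_rel_ext h _ => w; rewrite mul0r expR0.
Qed.

(* A majorant of [|w|] whose moments come from [E exp (t W) = exp (t^2 sW2 / 2)]. *)
Definition cosh2 (w : R) : R := expR (1 * w) + expR (-1 * w).

Lemma ler_norm_cosh2 (w : R) : `|w| <= cosh2 w.
Proof.
rewrite /cosh2 mul1r mulN1r; have := expR_ge1Dx w; have := expR_ge1Dx (- w).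
have := expR_gt0 w; have := expR_gt0 (- w).
by move=> *; rewrite ler_norml; apply/andP; split; lra.
Qed.

Lemma ler_sqr_cosh2 (w : R) : w ^+ 2 <= 2 * cosh2 w.
Proof.
rewrite /cosh2 mul1r mulN1r.
have h (u : R) : 0 <= u -> 1 + u ^+ 2 / 2 <= expR u.
  by move=> u0; have := expR_ge1Dxn 1 u0.
have := expR_gt0 w; have := expR_gt0 (- w).
case: (lerP 0 w) => w0; first by have := h _ w0; lra.
by have := h (- w); rewrite sqrrN; lra.
Qed.

Lemma noise_rel_cosh2 : noise_rel sW2 cosh2 (2 * expR (sW2 / 2)).
Proof.
have := noise_relD _ _ _ _ (noise_rel_expR 1) (noise_rel_expR (-1)).
by rewrite sqrrN expr1n mul1r -mulr2n mulr_natl.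
Qed.

Lemma noise_rel_cosh2_sqr : exists v, noise_rel sW2 (fun w => cosh2 w ^+ 2) v.
Proof.
have h := noise_relD _ _ _ _ (noise_relD _ _ _ _ (noise_rel_expR 2) (noise_rel_expR (-2)))
  (noise_relZ 2 _ _ noise_rel1).
eexists; apply: noise_rel_ext h _ => w.
have e : expR (1 * w) * expR (-1 * w) = 1.
  by rewrite -expRD (_ : _ + _ = 0) ?expR0//; ring.
have e2 (c : R) : expR (2 * c * w) = expR (c * w) ^+ 2.
  by rewrite -expRM_natl mulrA.
rewrite /cosh2 sqrrD e -!e2 (_ : 2 * 1 = 2) ?mulr1// (_ : 2 * -1 = -2) ?mulrN1//.
by ring.
Qed.

Lemma noise_pdf_dominated (a : R -> R) (c x : R) : measurable_fun setT a ->
  (forall w, `|a w| <= c * cosh2 w) ->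
  exists v, leb_rel (fun y => noise_pdf sW2 (y - x) * a (y - x)) v.
Proof.
move=> ma ac; apply: leb_rel_dominated (noise_relZ c _ _ noise_rel_cosh2 x) _ _.
  have mB : measurable_fun setT (fun y : R => y - x).
    by apply: measurable_funB => //; exact: measurable_cst.
  apply: measurable_funM.
    by apply: measurableT_comp mB; exact: measurable_noise_pdf.
  exact: measurableT_comp mB.
by move=> y; rewrite normrM ger0_norm ?noise_pdf_ge0// ler_wpM2l// noise_pdf_ge0.
Qed.

(* Comparing [1 + t w <= expR (t w)] in mean, for all small [t] of both signs. *)
Lemma noise_rel_id : noise_rel sW2 id 0.
Proof.
move=> x.
have [|v hv] := noise_pdf_dominated id 1 x (@measurable_id _ _ _).
  by move=> w; rewrite mul1r ler_norm_cosh2.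
suff <- : v = 0 by [].
have key t : 1 + t * v <= expR (t ^+ 2 * sW2 / 2).
  have h := lr_add _ _ (leb_rel_linear R) _ _ _ _ (noise_rel1 x)
    (lr_scale _ _ (leb_rel_linear R) t _ _ hv).
  apply: (leb_rel_le _ _ _ _ _ h (noise_rel_expR t x)) => y /=.
  rewrite mulrCA -mulrDr ler_wpM2l ?noise_pdf_ge0//.
  exact: expR_ge1Dx.
apply/eqP; apply: contraT => v0.
have v2 : 0 < v ^+ 2 by rewrite exprn_even_gt0.
(* This replaces the exponential by a rational bound, so that the contradiction becomes
   polynomial. *)
have up (u : R) : u < 1 -> expR u <= (1 - u)^-1.
  move=> u1; rewrite -[u]opprK expRN opprK lef_pV2 ?posrE ?expR_gt0 ?subr_gt0//.
  exact: expR_ge1Dx.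
(* At [t = e * v], with [a = e * v ^+ 2] and [b = e * sW2] both below 1, the bounds give
   [(1 + a) * (1 - a * b / 2) <= 1], which is false for [a > 0]. *)
pose e := (1 + sW2 + v ^+ 2)^-1.
have D0 : 0 < 1 + sW2 + v ^+ 2 by rewrite !addr_gt0.
have e0 : 0 < e by rewrite invr_gt0.
have eD : e * (1 + sW2 + v ^+ 2) = 1 by rewrite mulVf ?gt_eqF.
have es0 : 0 < e * sW2 by exact: mulr_gt0.
have ev0 : 0 < e * v ^+ 2 by exact: mulr_gt0.
have eD' : e + e * sW2 + e * v ^+ 2 = 1 by rewrite -eD; ring.
have es : e * sW2 < 1 by lra.
have ev : e * v ^+ 2 < 1 by lra.
have esv : (e * v ^+ 2) * (e * sW2) < e * v ^+ 2 by rewrite gtr_pMr.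
pose u := (e * v) ^+ 2 * sW2 / 2.
have uE : u = (e * v ^+ 2) * (e * sW2) / 2 by rewrite /u; field.
have u1 : u < 1 by rewrite uE; lra.
have := le_trans (key (e * v)) (up _ u1).
rewrite -[X in _ <= X]mul1r ler_pdivlMr ?subr_gt0//.
have -> : e * v * v = e * v ^+ 2 by ring.
rewrite uE; move: (e * v ^+ 2) (e * sW2) ev ev0 es es0 esv => a b a1 a0 b1 b0 ab.
have aab : a * (a * b) < a by rewrite gtr_pMr// (lt_trans ab).
lra.
Qed.

Lemma normal_peakE (s : R) : 0 < s -> normal_peak s = s^-1 * normal_peak 1.
Proof.
move=> s0; rewrite /normal_peak -mulrnAr sqrtrM ?sqr_ge0// sqrtr_sqr gtr0_norm//.
by rewrite expr1n mul1r invfM.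
Qed.

(* Comparing the density of variance [sW2] with the one of variance [r ^+ 2 * sW2],
   for [r] on either side of [1]. *)
Lemma noise_rel_sqr : noise_rel sW2 (fun w => w ^+ 2) sW2.
Proof.
move=> x.
have [||v hv] := noise_pdf_dominated (fun w => w ^+ 2) 2 x.
- by apply: measurable_funX; exact: measurable_id.
- by move=> w; rewrite ger0_norm ?sqr_ge0// ler_sqr_cosh2.
suff e : v = sW2 by rewrite -[X in leb_rel _ X]e.
(* The density of deviation [r * sigma], times [r], is the noise density times some [expR u];
   integrating [1 + u <= expR u] gives this bound. *)
have key r : 0 < r -> 1 + (1 - (r ^+ 2)^-1) / (2 * sW2) * v <= r.
  move=> r0.
  have h := lr_add _ _ (leb_rel_linear R) _ _ _ _ (noise_rel1 x)
    (lr_scale _ _ (leb_rel_linear R) ((1 - (r ^+ 2)^-1) / (2 * sW2)) _ _ hv).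
  have h' := lr_scale _ _ (leb_rel_linear R) r _ _ (normal_rel x (r * sigma)).
  rewrite mulr1 in h'.
  apply: (leb_rel_le _ _ _ _ _ h h') => y /=.
  have rs0 : 0 < r * sigma by exact: mulr_gt0.
  rewrite mulrCA -mulrDr normal_pdfE ?gt_eqF//= noise_pdfE /normal_fun.
  rewrite (normal_peakE (r * _))// (normal_peakE sigma)//.
  have rs : r * (r * sigma)^-1 = sigma^-1 by rewrite invfM mulVKf ?gt_eqF.
  rewrite [X in _ <= X]mulrA [X in _ <= X * _]mulrA rs -!mulrA.
  rewrite ler_pM2l ?invr_gt0// ler_pM2l; last exact: normal_peak_gt0.
  rewrite exprMn sigma2.
  set u := (1 - _) * _.
  apply: le_trans (ler_wpM2l (expR_ge0 _) (expR_ge1Dx u)) _.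
  rewrite -expRD ler_expR le_eqVlt; apply/orP; left; apply/eqP; rewrite /u.
  by field; rewrite !gt_eqF.
pose k := v / sW2.
have vE : v = k * sW2 by rewrite /k divfK// gt_eqF.
(* The factor [r - 1] changes sign at 1, so values of [r] on the two sides bound [k] from both
   sides. *)
have key2 r : 0 < r -> (r - 1) * (k * (r + 1)) <= (r - 1) * (2 * r ^+ 2).
  move=> r0; have := key r r0.
  rewrite -(ler_pM2r (_ : 0 < 2 * r ^+ 2)) ?mulr_gt0 ?exprn_gt0//.
  rewrite (_ : (1 + _) * _ = 2 * r ^+ 2 + (r - 1) * (k * (r + 1))); first lra.
  by rewrite vE; field; rewrite !gt_eqF.
suff k1 : k = 1 by rewrite vE k1 mul1r.
have k0 : 0 <= k.
  apply: divr_ge0 (ltW sW2_gt0).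
  have z := lr_scale _ _ (leb_rel_linear R) 0 _ _ hv; rewrite mul0r in z.
  apply: (leb_rel_le _ _ _ _ _ z hv) => y /=.
  by rewrite mul0r mulr_ge0 ?noise_pdf_ge0 ?sqr_ge0.
have [kl|kg|//] := ltrgtP k 1.
  pose r := 1 - (1 - k) / 4.
  have r0 : 0 < r by rewrite /r; lra.
  have := key2 r r0; rewrite ler_nM2l; last by rewrite /r; lra.
  by rewrite /r; nra.
have K0 : 0 < k + 3 by lra.
pose e := (k - 1) / (k + 3).
have e0 : 0 < e by rewrite divr_gt0// subr_gt0.
have e1 : e < 1 by rewrite ltr_pdivrMr//; lra.
have eK : e * (k + 3) = k - 1 by rewrite divfK// gt_eqF.
have := key2 (1 + e); rewrite ler_pM2l; last by lra.
move=> /(_ (addr_gt0 ltr01 e0)); nra.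
Qed.

End Noise.

(** A centred majorant of [|w|], up to a constant, with finite second moment: what Chebyshev's
    inequality needs for the noise. *)
Lemma noise_rel_cosh2_center (R : realType) (sW2 : R) : 0 < sW2 ->
  let q := fun w : R => cosh2 w - 2 * expR (sW2 / 2) in
  noise_rel sW2 q 0 /\ exists v, noise_rel sW2 (fun w => q w ^+ 2) v.
Proof.
move=> s0 q; set c := 2 * expR (sW2 / 2) in q *.
have hc := noise_rel_cosh2 _ s0; have h1 := noise_rel1 _ s0.
split.
  have h := noise_relD _ _ _ _ _ hc (noise_relZ _ (- c) _ _ h1).
  by rewrite mulr1 subrr in h; apply: noise_rel_ext h _ => w; rewrite /= ?mulr1.
have [v hv] := noise_rel_cosh2_sqr _ s0.
have h := noise_relD _ _ _ _ _ hv (noise_relD _ _ _ _ _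
  (noise_relZ _ (- (2 * c)) _ _ hc) (noise_relZ _ (c ^+ 2) _ _ h1)).
by eexists; apply: noise_rel_ext h _ => w /=; rewrite /q; ring.
Qed.

(** * Moments of the source *)

Section Source.
Context {R : realType}.
Variable f : R -> R.
Hypothesis f_density : is_density f.
Hypothesis f_var : finite_variance f.

Let mf : measurable_fun setT f. Proof. by case: f_density. Qed.
Let f0 x : 0 <= f x. Proof. by case: f_density => _ []. Qed.

Lemma source_relD (a b : R -> R) (u v : R) : source_rel f a u -> source_rel f b v ->
  source_rel f (fun w => a w + b w) (u + v).
Proof.
move=> ha hb; apply: leb_rel_ext (lr_add _ _ (leb_rel_linear R) _ _ _ _ ha hb) _.
by move=> y; rewrite mulrDr.
Qed.

Lemma source_relZ (c : R) (a : R -> R) (u : R) : source_rel f a u ->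
  source_rel f (fun w => c * a w) (c * u).
Proof.
move=> ha; apply: leb_rel_ext (lr_scale _ _ (leb_rel_linear R) c _ _ ha) _.
by move=> y; rewrite mulrCA.
Qed.

Lemma source_rel_ext (a b : R -> R) (u : R) : source_rel f a u -> a =1 b ->
  source_rel f b u.
Proof. by move=> h /funext <-. Qed.

Lemma source_rel1 : source_rel f (fun=> 1) 1.
Proof.
have e : (\int[@lebesgue_measure R]_x (f x)%:E = 1)%E by case: f_density => _ [].
apply: (@leb_rel_ext _ f) => [|x]; last by rewrite mulr1.
split=> //; apply/integrableP; split; first exact/measurable_EFinP.
under eq_integral do rewrite /= ger0_norm//.
by rewrite e ltry.
Qed.

Lemma source_rel_sqr : exists v, source_rel f (fun x => x ^+ 2) v.
Proof.
have i2 : (@lebesgue_measure R).-integrable setT (fun x => (f x * x ^+ 2)%:E).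
  apply/integrableP; split.
    by apply/measurable_EFinP; apply: measurable_funM => //; exact: measurable_funX.
  have E x : `|(f x * x ^+ 2)%:E|%E = (x ^+ 2 * f x)%:E.
    by rewrite abse_EFin mulrC ger0_norm// mulr_ge0// sqr_ge0.
  by under eq_integral do rewrite E; exact: f_var.
exists (fine (\int[@lebesgue_measure R]_x (f x * x ^+ 2)%:E)); split => //.
by rewrite fineK//; exact: integrable_fin_num.
Qed.

Lemma source_dominated (b : R -> R) (c : R) : measurable_fun setT b ->
  (forall x, `|b x| <= c * (1 + x ^+ 2)) -> exists v, source_rel f b v.
Proof.
move=> mb bc; have [v hv] := source_rel_sqr.
have h := source_relZ c _ _ (source_relD _ _ _ _ source_rel1 hv).
apply: (leb_rel_dominated _ _ _ _ h) => [|x]; first exact: measurable_funM.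
by rewrite normrM (ger0_norm (f0 x)) ler_wpM2l.
Qed.

Lemma source_rel_id : source_rel f id (meanX f).
Proof.
have [|v hv] := source_dominated id 1 (@measurable_id _ _ _).
  move=> x /=; rewrite mul1r ler_norml; apply/andP; split; nra.
suff -> : meanX f = v by [].
rewrite /meanX /Rintegral.
by under eq_integral do rewrite mulrC; case: hv => _ ->.
Qed.

Lemma source_rel_center : source_rel f (fun x => x - meanX f) 0.
Proof.
have h := source_relD _ _ _ _ source_rel_id (source_relZ (- meanX f) _ _ source_rel1).
by rewrite mulr1 subrr in h; apply: source_rel_ext h _ => x; rewrite /= ?mulr1.
Qed.

Lemma source_rel_var : source_rel f (fun x => (x - meanX f) ^+ 2) (varX f).
Proof.
have [u hu] := source_rel_sqr; set m := meanX f.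
have h := source_relD _ _ _ _ hu (source_relD _ _ _ _
  (source_relZ (- (2 * m)) _ _ source_rel_id) (source_relZ (m ^+ 2) _ _ source_rel1)).
have {}h : source_rel f (fun x => (x - m) ^+ 2)
    (u + (- (2 * m) * m + m ^+ 2 * 1)).
  by apply: source_rel_ext h _ => x /=; ring.
move: h; set v := (X in source_rel f _ X) => h.
suff -> : varX f = v by [].
rewrite /varX /Rintegral.
by under eq_integral do rewrite mulrC; case: h => _ ->.
Qed.

Lemma source_rel_abs : exists mu v : R,
  [/\ source_rel f (fun x => `|x| - mu) 0,
    source_rel f (fun x => (`|x| - mu) ^+ 2) v & 0 <= mu].
Proof.
have mn : measurable_fun setT (fun x : R => `|x|) by exact: measurableT_comp.
have [|mu hmu] := source_dominated (fun x => `|x|) 1 mn.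
  by move=> x; rewrite mul1r normr_id ler_norml; apply/andP; split; nra.
have [u hu] := source_rel_sqr.
exists mu; eexists; split.
- have h := source_relD _ _ _ _ hmu (source_relZ (- mu) _ _ source_rel1).
  by rewrite mulr1 subrr in h; apply: source_rel_ext h _ => x; rewrite /= ?mulr1.
- have h := source_relD _ _ _ _ hu (source_relD _ _ _ _
    (source_relZ (- (2 * mu)) _ _ hmu) (source_relZ (mu ^+ 2) _ _ source_rel1)).
  by apply: source_rel_ext h _ => x /=; rewrite -[x ^+ 2]real_normK ?num_real//; ring.
have z := lr_scale _ _ (leb_rel_linear R) 0 _ _ hmu; rewrite mul0r in z.
by apply: (leb_rel_le _ _ _ _ _ z hmu) => x; rewrite mul0r mulr_ge0.
Qed.

(** For [T >= 0] the overload error satisfies [x ^+ 2 <= T + tail_sqr T x]: the tail is small in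
    mean, and [T] is charged to the overload probability. *)
Definition tail_sqr (T x : R) : R := if T < x ^+ 2 then x ^+ 2 else 0.

(** Dominated convergence along integer thresholds, with [x ^+ 2] as dominating function; at each
    point the tail is eventually 0. *)
Lemma source_rel_tail (e : R) : 0 < e ->
  exists T v : R, [/\ 0 <= T, v <= e & source_rel f (tail_sqr T) v].
Proof.
move=> e0; have [u hu] := source_rel_sqr.
pose F (n : nat) (x : R) := (f x * tail_sqr n%:R x)%:E.
have mt (n : nat) : measurable_fun setT (tail_sqr n%:R).
  have m2 : measurable_fun setT (fun x : R => x ^+ 2) by exact: measurable_funX.
  apply: measurable_fun_ifT => //.
  exact: measurable_fun_ltr.
have tail_ge0 (T x : R) : 0 <= tail_sqr T x.
  by rewrite /tail_sqr; case: ifP => // _; exact: sqr_ge0.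
have tail_le (T x : R) : tail_sqr T x <= x ^+ 2.
  by rewrite /tail_sqr; case: ifP => // _; exact: sqr_ge0.
have hn (n : nat) : exists v, source_rel f (tail_sqr n%:R) v.
  apply: (source_dominated _ 1) => // x; rewrite ger0_norm// mul1r.
  by rewrite (le_trans (tail_le _ _))// lerDr.
have mF (n : nat) : measurable_fun setT (fun x => f x * tail_sqr n%:R x).
  exact: measurable_funM.
have [] := @dominated_convergence _ _ _ (@lebesgue_measure R) setT measurableT F
  (cst 0%E) (fun x => (f x * x ^+ 2)%:E).
- by move=> n; apply/measurable_EFinP; exact: mF.
- exact: measurable_cst.
- apply: aeW => x _; apply: cvg_near_cst; near=> n.
  rewrite /F /tail_sqr ltNge (_ : x ^+ 2 <= n%:R) ?mulr0//.
  by near: n; exact: nbhs_infty_ger.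
- by case: hu.
- apply: aeW => x n _; rewrite /F lee_fin /= ger0_norm ?mulr_ge0//.
  exact: ler_wpM2l.
rewrite integral0 => _ _ /fine_cvgP [_ /cvgrPdist_le /(_ e e0)] [N _ /(_ N (leqnn N))].
have [v hv] := hn N.
rewrite /= sub0r normrN (_ : (\int[lebesgue_measure]_x F N x = v%:E)%E); last by case: hv.
move=> /= ve; exists N%:R, v; split => //.
exact: le_trans (ler_norm v) ve.
Unshelve. all: by end_near. Qed.

End Source.

(** * Dithered scalar quantization *)

Section Quantizer.
Context {R : realType}.

Lemma sum_ord_natr (L : nat) : \sum_(j < L) (j%:R : R) = L%:R * (L%:R - 1) / 2.
Proof.
elim: L => [|L IH]; first by rewrite big_ord0 !mul0r.
by rewrite big_ord_recr /= IH -natr1; field.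
Qed.

(** Counts the dithers that carry a fractional part past the next integer. *)
Lemma sum_leq_addn (L p : nat) : (p <= L)%N ->
  (\sum_(j < L) (L <= p + j)%N)%N = p.
Proof.
move=> pL; rewrite (reindex_inj rev_ord_inj) /=.
rewrite (eq_bigr (fun j : 'I_L => if (j < p)%N then 1%N else 0%N)); last first.
  move=> j _; have jL := ltn_ord j.
  suff -> : (L <= p + (L - j.+1))%N = (j < p)%N by case: ltnP.
  by apply/idP/idP; lia.
rewrite -big_mkcond /= -(big_ord_widen _ (fun=> 1%N))//.
by rewrite sum1_card card_ord.
Qed.

(** Signed error of rounding [y] to the midpoint of its cell, in the grid of step [dl] translated by
    [- u * dl]. *)
Definition quant_err (dl u y : R) : R :=
  dl * ((Num.floor (y / dl + u))%:~R + 2^-1 - u) - y.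

Lemma floor_bounds (x : R) : (Num.floor x)%:~R <= x /\ x < (Num.floor x)%:~R + 1.
Proof. by have /andP[? ?] := Num.Theory.floor_itv x; rewrite -intrD1. Qed.

Lemma quant_err_le (dl u y : R) : 0 < dl -> `|quant_err dl u y| <= dl.
Proof.
move=> d0; rewrite /quant_err.
have -> : dl * ((Num.floor (y / dl + u))%:~R + 2^-1 - u) - y =
    dl * ((Num.floor (y / dl + u))%:~R + 2^-1 - (y / dl + u)).
  by field; rewrite gt_eqF.
rewrite normrM gtr0_norm//; apply: ler_piMr; first exact: ltW.
have [? ?] := floor_bounds (y / dl + u).
by rewrite ler_norml; apply/andP; split; lra.
Qed.

(* With dithers [j / L] the errors at a point nearly cancel (Hermite's identity). *)
Lemma quant_err_sum (dl y : R) (L : nat) : 0 < dl -> (0 < L)%N ->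
  `|\sum_(j < L) quant_err dl (j%:R / L%:R) y| <= dl.
Proof.
move=> d0 L0; have L0' : (0 : R) < L%:R by rewrite ltr0n.
pose m := Num.floor (y / dl); pose fr := y / dl - m%:~R.
have [m1 m2] := floor_bounds (y / dl); rewrite -/m in m1 m2.
have fr0 : 0 <= fr by rewrite subr_ge0.
have fr1 : fr < 1 by rewrite /fr; lra.
have Lfr0 : 0 <= L%:R * fr by rewrite mulr_ge0.
pose p := Num.truncn (L%:R * fr).
have /andP[p1 p2] := Num.Theory.truncn_itv Lfr0; rewrite -/p -natr1 in p1 p2.
have Lfr1 : L%:R * fr < L%:R by rewrite gtr_pMr.
have pL : (p < L)%N by rewrite -(ltr_nat R); exact: le_lt_trans p1 _.
(* Dither [j / L] raises the floor by one exactly when [p + j] reaches [L], which happens for [p] of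
   the [L] dithers. *)
have flE (j : 'I_L) : (Num.floor (y / dl + j%:R / L%:R))%:~R =
    m%:~R + ((L <= p + j)%N : nat)%:R :> R.
  have jL : (j%:R : R) + 1 <= L%:R by rewrite natr1 ler_nat.
  have jfr : y / dl + j%:R / L%:R = m%:~R + (L%:R * fr + j%:R) / L%:R.
    by rewrite /fr; field; rewrite !gt_eqF.
  have pm (k : nat) : (k%:R : R) = (k%:Z)%:~R by rewrite -pmulrn.
  rewrite (pm (L <= p + j)%N) -intrD; congr _%:~R; apply: Num.Theory.floor_def.
  rewrite jfr !intrD -pm -addrA !lerD2l !ltrD2l.
  rewrite ler_pdivlMr// ltr_pdivrMr//.
  have [Lp|Lp] := leqP L (p + j).
    move: Lp; rewrite -(ler_nat R) natrD /= => Lp.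
    by rewrite mulr1n; apply/andP; split; lra.
  have {}Lp : (p%:R + j%:R + 1 : R) <= L%:R by rewrite -natrD natr1 ler_nat.
  have j0 : (0 : R) <= j%:R by [].
  by rewrite mulr0n; apply/andP; split; lra.
(* In this closed form [p] is the integer part of [L * fr], so the bracket has absolute value at
   most one half. *)
have -> : \sum_(j < L) quant_err dl (j%:R / L%:R) y =
    dl * (p%:R + 2^-1 - L%:R * fr).
  rewrite -[in RHS](sum_leq_addn L p) ?(ltnW pL)// natr_sum.
  transitivity (\sum_(j < L) (dl * ((L <= p + j)%N : nat)%:R +
    (dl * (m%:~R + 2^-1) - y) - dl / L%:R * j%:R)).
    apply: eq_bigr => j _; rewrite /quant_err flE.
    by field; rewrite gt_eqF.
  rewrite sumrB big_split /= sumr_const card_ord -!mulr_sumr -mulr_natr.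
  by rewrite sum_ord_natr /fr; field; rewrite !gt_eqF.
rewrite normrM gtr0_norm//; apply: ler_piMr; first exact: ltW.
by rewrite ler_norml; apply/andP; split; lra.
Qed.

Lemma inord_out (n k : nat) : (n < k)%N -> inord k = ord0 :> 'I_n.+1.
Proof. by move=> nk; rewrite /inord /insubd insubN //= ltnS -ltnNge. Qed.

(** The offset [S] makes the letter [S] stand for grid index 0. Samples below the range reach [ord0]
    through [truncn], those above through the default value of [inord]. *)
Definition cell (dl u : R) (S : nat) (y : R) : 'I_(S + S).+1 :=
  inord (Num.truncn (y / dl + u + S%:R)).

Definition cell_mid (dl u : R) (S : nat) (k : nat) : R :=
  dl * (k%:R - S%:R + 2^-1 - u).

Definition absd (S k : nat) : nat := (k - S) + (S - k).

Lemma absdE (S k : nat) : (absd S k)%:R = `|k%:R - S%:R| :> R.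
Proof.
rewrite /absd; have [kS|Sk] := leqP k S.
  rewrite (eqP kS) add0n natrB// distrC ger0_norm// subr_ge0 ler_nat//.
rewrite (_ : (S - k = 0)%N) ?addn0 ?natrB ?(ltnW Sk)//; last by lia.
by rewrite ger0_norm// subr_ge0 ler_nat ltnW.
Qed.

(** A letter other than [ord0] certifies that the sample was not clipped, so [truncn] agrees with
    the floor. *)
Lemma cell_midE (dl u y : R) (S : nat) : cell dl u S y != ord0 ->
  cell_mid dl u S (cell dl u S y) = y + quant_err dl u y.
Proof.
move=> c0; rewrite /cell_mid /quant_err [RHS]addrC subrK; congr (_ * (_ + _ - _)).
set v := y / dl + u + S%:R.
have cE : cell dl u S y = Num.truncn v :> nat.
  have [vS|vS] := ltnP (S + S) (Num.truncn v); last by rewrite /cell -/v inordK.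
  by move: c0; rewrite /cell -/v inord_out ?eqxx.
have c1 : (0 < cell dl u S y)%N by rewrite lt0n.
have v0 : 0 <= v.
  by rewrite cE in c1; case: (leP 0 v) => // v0; rewrite truncn_floor leNgt v0 in c1.
have /andP[t1 t2] := Num.Theory.truncn_itv v0.
rewrite cE (_ : Num.floor _ = (Num.truncn v)%:Z - S%:Z) ?intrB//.
apply: Num.Theory.floor_def; rewrite intrD1 intrB -!pmulrn.
by move: t1 t2; rewrite -natr1 /v => *; apply/andP; split; lra.
Qed.

(** Clipping does no harm: [ord0] costs [S], but a clipped sample has [|y| / dl] at least [S].
    Otherwise dither and rounding account for the 2. *)
Lemma absd_cell (dl u y : R) (S : nat) : 0 < dl -> 0 <= u -> u <= 1 ->
  (absd S (cell dl u S y))%:R <= `|y| / dl + 2.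
Proof.
move=> d0 u0 u1; rewrite absdE.
have -> : `|y| / dl = `|y / dl| by rewrite normrM normfV (gtr0_norm d0).
set z := y / dl; have z1 := ler_norm z; have z2 := ler_norm (- z).
rewrite normrN in z2.
have S0 : (0 : R) <= S%:R by [].
have out : S%:R <= `|z| + 2 -> (cell dl u S y = ord0) ->
    `|(cell dl u S y)%:R - S%:R| <= `|z| + 2.
  by move=> h ->; rewrite /= sub0r normrN ger0_norm.
set v := z + u + S%:R.
have [v0|v0] := leP 0 v; last first.
  apply: out; first by rewrite /v in v0; lra.
  by rewrite /cell -/z -/v truncn_floor leNgt v0 /=; apply/val_inj; rewrite /= inordK.
have /andP[t1 t2] := Num.Theory.truncn_itv v0.
have [tS|tS] := leqP (Num.truncn v) (S + S).
  rewrite /cell -/z -/v inordK ?ltnS// ler_norml.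
  by move: t1 t2; rewrite -natr1 /v => *; apply/andP; split; lra.
apply: out.
  have : ((S + S).+1%:R : R) <= v by apply: le_trans t1; rewrite ler_nat.
  by rewrite -natr1 natrD /v; lra.
rewrite /cell -/z -/v; apply/val_inj.
by rewrite inord_out.
Qed.

End Quantizer.

(** * The codebook *)

Section Codebook.
Context {R : realType}.

Definition word (dl u : R) (S n : nat) (y : n.-tuple R) :
    {ffun 'I_n -> 'I_(S + S).+1} := [ffun t => cell dl u S (tnth y t)].

Definition small_word (S n : nat) (w : {ffun 'I_n -> 'I_(S + S).+1}) : bool :=
  (\sum_(t < n) absd S (w t) < S)%N.

Definition book (S n : nat) : seq {ffun 'I_n -> 'I_(S + S).+1} :=
  enum (small_word S n).

(** For a word outside the book, [index] returns the size of the book; this extra value is the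
    overload message. *)
Definition encode (dl u : R) (S n : nat) (y : n.-tuple R) : nat :=
  index (word dl u S n y) (book S n).

Lemma mem_book (S n : nat) (w : {ffun 'I_n -> 'I_(S + S).+1}) :
  (w \in book S n) = small_word S n w.
Proof. by rewrite mem_enum. Qed.

(* The letter [ord0], which collects the clipped samples, costs the full budget [S]. *)
Lemma small_word_neq0 (S n : nat) (w : {ffun 'I_n -> 'I_(S + S).+1}) t :
  small_word S n w -> w t != ord0.
Proof.
rewrite /small_word (bigD1 t)//=; apply: contraTN => /eqP ->.
by rewrite -leqNgt /absd /= sub0n add0n subn0 leq_addr.
Qed.

Lemma small_word_overload (dl u : R) (S n : nat) (y : n.-tuple R) :
  0 < dl -> 0 <= u -> u <= 1 -> ~~ small_word S n (word dl u S n y) ->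
  dl * (S%:R - 2 * n%:R) <= \sum_(t < n) `|tnth y t|.
Proof.
move=> d0 u0 u1; rewrite /small_word -leqNgt -(ler_nat R) natr_sum => h.
have {}h : S%:R <= \sum_(t < n) (`|tnth y t| / dl + 2).
  apply: le_trans h _; apply: ler_sum => t _; rewrite ffunE.
  exact: absd_cell.
rewrite big_split /= sumr_const card_ord -mulr_suml -[_ *+ n]mulr_natr in h.
by rewrite mulrC -ler_pdivlMr//; lra.
Qed.

Lemma sum_expr_absd (x : R) (S : nat) : 0 <= x -> x < 1 ->
  (\sum_(0 <= k < (S + S).+1) x ^+ absd S k) * (1 - x) <= 2.
Proof.
move=> x0 x1.
(* The sharper bound makes the induction work: its remainder absorbs the two new end terms. *)
suff : (\sum_(0 <= k < (S + S).+1) x ^+ absd S k) * (1 - x) <= 2 - 2 * x ^+ S.+1.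
  have xS : 0 <= x ^+ S.+1 by exact: exprn_ge0.
  by move=> *; lra.
elim: S => [|S IH]; first by rewrite big_nat1 /absd /= expr0 expr1; lra.
rewrite addSn addnS big_nat_recl// big_nat_recr//=.
rewrite (eq_bigr (fun k => x ^+ absd S k)) => [|k _]; last by rewrite /absd !subSS.
rewrite (_ : absd S.+1 0 = S.+1); last by rewrite /absd sub0n subn0.
rewrite (_ : absd S.+1 (S + S).+2 = S.+1); last by rewrite /absd; lia.
move: IH; set G := (X in X * _ <= _) => IH.
rewrite (exprS x S.+1).
by rewrite -/G; set p := x ^+ S.+1 in IH *; lra.
Qed.

(** Exponential weighting: each small word has weight [expR (dl * S) * \prod_t x ^+ absd S (w t) >=
    1], and the sum of the weights over all words factors into one-letter sums, each at most
    [4 / dl]. *)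
Lemma size_book (dl : R) (S n : nat) : 0 < dl -> dl <= 1 ->
  (size (book S n))%:R <= expR (dl * S%:R) * (4 / dl) ^+ n.
Proof.
move=> d0 d1; set x := expR (- dl).
have x0 : 0 < x by exact: expR_gt0.
have x1 : 1 - x >= dl / 2.
  rewrite /x expRN.
  have le1 : (expR dl)^-1 <= (1 + dl)^-1.
    by rewrite lef_pV2 ?posrE ?expR_gt0 ?expR_ge1Dx//; lra.
  have D0 : 0 < 1 + dl by lra.
  have : (1 + dl)^-1 <= 1 - dl / 2 by rewrite -[X in X <= _]mul1r ler_pdivrMr//; nra.
  lra.
have G4 : \sum_(k < (S + S).+1) x ^+ absd S k <= 4 / dl.
  set G := (X in X <= _).
  have x1' : x < 1 by lra.
  have H : G * (1 - x) <= 2.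
    by rewrite /G -(big_mkord xpredT (fun k => x ^+ absd S k)) sum_expr_absd ?ltW.
  have G0 : 0 <= G by apply: sumr_ge0 => k _; exact: exprn_ge0 (ltW x0).
  by have := ler_wpM2l G0 x1; rewrite ler_pdivlMr// => *; lra.
rewrite /book -cardE -sum1_card natr_sum.
apply: (@le_trans _ _ (\sum_(w in small_word S n)
    expR (dl * S%:R) * \prod_(t < n) x ^+ absd S (w t))).
  apply: ler_sum => w; rewrite unfold_in => sw.
  rewrite -expr_sum /x -expRM_natl -expRD -[X in X <= _]expR0 ler_expR.
  by rewrite mulrN mulrC -mulrBl mulr_ge0 ?(ltW d0)// subr_ge0 ler_nat ltnW.
rewrite -mulr_sumr ler_wpM2l ?expR_ge0//.
apply: (@le_trans _ _ (\sum_(w : {ffun 'I_n -> 'I_(S + S).+1})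
    \prod_(t < n) x ^+ absd S (w t))).
  rewrite [X in _ <= X](bigID (small_word S n)) /= lerDl.
  by apply: sumr_ge0 => w _; apply: prodr_ge0 => t _; exact: exprn_ge0 (ltW x0).
rewrite -(bigA_distr_bigA (fun _ k => x ^+ absd S (nat_of_ord k))) prodr_const card_ord.
apply: lerXn2r => //; rewrite nnegrE; first by apply: sumr_ge0 => k _; exact: exprn_ge0 (ltW x0).
by rewrite divr_ge0// ltW.
Qed.

End Codebook.

(** * Measurability and rate of the encoder *)

Section Encoder.
Context {R : realType}.

Lemma measurable_truncn : measurable_fun setT (fun z : R => (Num.truncn z)%:R : R).
Proof.
apply: nondecreasing_measurable => // a b ab.
by rewrite ler_nat; exact: le_truncn.
Qed.

(** Reduces the events of a letter to comparisons of the real number [k], a measurable function of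
    [y]; the second alternative is overflow above the range. *)
Lemma cell_eq (dl u y : R) (S : nat) (a : 'I_(S + S).+1) :
  let k : R := (Num.truncn (y / dl + u + S%:R))%:R in
  (cell dl u S y == a) = (k == a%:R) || ((a == ord0) && ((S + S)%:R < k)).
Proof.
rewrite /= eqr_nat ltr_nat /cell; set k := Num.truncn _.
have [kS|kS] := ltnP (S + S) k.
  rewrite inord_out// andbT [LHS]eq_sym orbC.
  by case: eqP => //= _; apply/esym/eqP => kE; have := ltn_ord a; rewrite -kE; lia.
by rewrite andbF orbF -val_eqE /= inordK.
Qed.

Lemma measurable_cell_eq (dl u : R) (S : nat) (a : 'I_(S + S).+1) :
  measurable_fun setT (fun y : R => cell dl u S y == a).
Proof.
have mg : measurable_fun setT (fun y : R => y / dl + u + S%:R).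
  by apply: measurable_funD => //; apply: measurable_funD => //; exact: measurable_funM.
have mk : measurable_fun setT
    (fun y : R => (Num.truncn (y / dl + u + S%:R))%:R : R).
  exact: (measurableT_comp measurable_truncn mg).
rewrite (_ : (fun y : R => cell dl u S y == a) = (fun y : R =>
  ((Num.truncn (y / dl + u + S%:R))%:R == a%:R :> R) ||
  ((a == ord0) && ((S + S)%:R < (Num.truncn (y / dl + u + S%:R))%:R :> R)))).
  apply: measurable_or; first exact: measurable_fun_eqr.
  by apply: measurable_and => //; exact: measurable_fun_ltr.
by apply/funext => y; rewrite cell_eq.
Qed.

Lemma measurable_word_eq (dl u : R) (S n : nat) (a : {ffun 'I_n -> 'I_(S + S).+1}) :
  measurable_fun setT (fun y : n.-tuple R => a == word dl u S n y).
Proof.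
rewrite (_ : (fun y : n.-tuple R => a == word dl u S n y) = (fun y : n.-tuple R =>
    all (fun t => cell dl u S (tnth y t) == a t) (enum 'I_n))); last first.
  apply/funext => y; apply/eqP/allP => [-> t _|h]; first by rewrite ffunE.
  by apply/ffunP => t; rewrite ffunE; apply/esym/eqP/h; rewrite mem_enum.
elim: (enum 'I_n) => [//|t r IH] /=; apply: measurable_and => //.
apply: (measurableT_comp (measurable_cell_eq dl u S (a t))).
exact: measurable_tnth.
Qed.

Lemma measurable_encode (dl u : R) (S n : nat) :
  measurable_fun setT (encode dl u S n : n.-tuple R -> nat).
Proof.
rewrite /encode; elim: (book S n) => [//|a r IH] /=.
apply: measurable_fun_ifT => //.
  exact: measurable_word_eq.
have mS : measurable_fun setT (fun k : nat => k.+1) by [].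
exact: (measurableT_comp mS IH).
Qed.

(** Having 8 in place of the 4 of [size_book] gains a factor [2 ^+ n >= 2], which pays for the
    overload message. *)
Lemma encode_lt_nidx (dl u K : R) (s n : nat) (y : n.-tuple R) :
  0 < dl -> dl <= 1 -> (0 < n)%N -> dl * s%:R <= K ->
  (encode dl u (n * s) n y < nidx n (K + ln (8 / dl)))%N.
Proof.
move=> d0 d1 n0 sK.
apply: (@leq_trans (size (book (n * s) n)).+1); first by rewrite ltnS index_size.
rewrite /nidx Num.Theory.truncn_ge_nat ?expR_ge0// -natr1.
have h := size_book dl (n * s) n d0 d1.
have q1 : 1 <= 4 / dl by rewrite ler_pdivlMr//; lra.
have X1 : 1 <= expR (n%:R * K) * (4 / dl) ^+ n.
  rewrite -[X in X <= _]mulr1; apply: ler_pM => //; last exact: exprn_ege1.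
  rewrite -[X in X <= _]expR0 ler_expR mulr_ge0//.
  by apply: le_trans sK; rewrite mulr_ge0// ltW.
have h2 : (size (book (n * s) n))%:R <= expR (n%:R * K) * (4 / dl) ^+ n.
  apply: le_trans h _; rewrite ler_wpM2r//; first by rewrite exprn_ge0//; lra.
  by rewrite ler_expR natrM mulrCA ler_wpM2l.
rewrite mulrDr expRD [X in _ <= _ * X]expRM_natl lnK ?posrE ?divr_gt0//.
have -> : 8 / dl = 2 * (4 / dl) by field; rewrite gt_eqF.
rewrite exprMn mulrCA.
have p2 : (2 : R) <= 2 ^+ n by rewrite -[X in X <= _]expr1 ler_weXn2l//; lra.
nra.
Qed.

End Encoder.

(** * Second moments of block sums *)

Section Moments.
Context {R : realType}.
Variables (f : R -> R) (sW2 : R) (n M : nat).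
Hypothesis f_density : is_density f.
Hypothesis f_var : finite_variance f.
Hypothesis sW2_gt0 : 0 < sW2.

Local Notation Jrel := (joint_rel f sW2 n M).
Let f1 := source_rel1 f f_density.
Let w1 := noise_rel1 sW2 sW2_gt0.

Lemma joint_rel_cst (c : R) : Jrel (fun _ _ => c) c.
Proof.
have h := joint_rel_prod f sW2 n M (fun=> fun=> 1) (fun=> 1) (fun=> fun=> 1) (fun=> 1)
  (fun=> f1) (fun=> w1).
have {}h := joint_relZ f sW2 n M c _ _ h; rewrite !big1_eq !mulr1 in h.
by apply: joint_rel_ext h _ => x y; rewrite /= ?big1_eq ?mulr1.
Qed.

Lemma joint_rel_sum (I : Type) (r : seq I)
  (F : I -> n.-tuple R -> M.-tuple (n.-tuple R) -> R) (v : I -> R) :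
  (forall i, Jrel (F i) (v i)) ->
  Jrel (fun x y => \sum_(i <- r) F i x y) (\sum_(i <- r) v i).
Proof.
move=> h; elim: r => [|i r IH].
  rewrite big_nil; apply: joint_rel_ext (joint_rel_cst 0) _ => x y.
  by rewrite big_nil.
rewrite big_cons; apply: joint_rel_ext (joint_relD _ _ _ _ _ _ _ _ (h i) IH) _ => x y.
by rewrite big_cons.
Qed.

(** For uncorrelated terms only the diagonal of the expanded square survives. *)
Lemma joint_rel_sqr_sum (I : finType)
  (F : I -> n.-tuple R -> M.-tuple (n.-tuple R) -> R) (V : R) :
  (forall i k, Jrel (fun x y => F i x y * F k x y) (if k == i then V else 0)) ->
  Jrel (fun x y => (\sum_i F i x y) ^+ 2) (#|I|%:R * V).
Proof.
move=> h.
have e : \sum_(i : I) \sum_(k : I) (if k == i then V else 0) = #|I|%:R * V.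
  under eq_bigr do rewrite -big_mkcond big_pred1_eq.
  by rewrite sumr_const mulr_natl.
rewrite -e; apply: joint_rel_ext (joint_rel_sum _ _ _ _ (fun i => joint_rel_sum _ _ _ _ (h i))) _.
by move=> x y; rewrite expr2 mulr_suml; apply: eq_bigr => i _; rewrite mulr_sumr.
Qed.

Lemma joint_rel_sqr_sum_x (b : R -> R) (V : R) :
  source_rel f b 0 -> source_rel f (fun x => b x ^+ 2) V ->
  Jrel (fun x y => (\sum_(t < n) b (tnth x t)) ^+ 2) (n%:R * V).
Proof.
move=> b0 b2; rewrite -[in n%:R](card_ord n); apply: joint_rel_sqr_sum => t u.
case: eqVneq => [->|ut]; last exact: joint_rel_xx.
by apply: joint_rel_ext (joint_rel_x _ _ _ _ f1 w1 t _ _ b2) _.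
Qed.

Lemma joint_rel_sqr_w (a : R -> R) (V : R) p : noise_rel sW2 (fun w => a w ^+ 2) V ->
  Jrel (fun x y => a (noise n M x y p) * a (noise n M x y p)) V.
Proof.
move=> a2; rewrite -[V]mul1r.
apply: joint_rel_ext (joint_rel_xw _ _ _ _ f1 w1 p.2 p _ _ _ _ f1 a2) _ => x y.
by rewrite mul1r.
Qed.

Lemma joint_rel_sqr_sum_w (a : R -> R) (V : R) (i : 'I_M) :
  noise_rel sW2 a 0 -> noise_rel sW2 (fun w => a w ^+ 2) V ->
  Jrel (fun x y => (\sum_(t < n) a (noise n M x y (i, t))) ^+ 2) (n%:R * V).
Proof.
move=> a0 a2; rewrite -[in n%:R](card_ord n); apply: joint_rel_sqr_sum => t u.
case: eqVneq => [->|ut]; first exact: joint_rel_sqr_w.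
by apply: joint_rel_ww => //; apply: contra ut => /eqP[->].
Qed.

Definition lin_err (g m : R) (x : n.-tuple R) (y : M.-tuple (n.-tuple R)) (t : 'I_n) : R :=
  tnth x t - m - g * \sum_(i < M) (tnth (tnth y i) t - m).

(** With [c = 1 - g * M] the error is [c * (X - m) - g * \sum_i W_i], a combination of independent
    centred variables. *)
Lemma joint_rel_lin_err (g : R) (t : 'I_n) :
  Jrel (fun x y => lin_err g (meanX f) x y t ^+ 2)
    ((1 - g * M%:R) ^+ 2 * varX f + g ^+ 2 * (M%:R * sW2)).
Proof.
set m := meanX f; set c := 1 - g * M%:R.
have hx := joint_rel_x f sW2 n M f1 w1 t _ _ (source_rel_var f f_density f_var).
have hxw : Jrel (fun x y => \sum_(i < M) ((tnth x t - m) * noise n M x y (i, t)))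
    (\sum_(i < M) (0 * 0)).
  apply: joint_rel_sum => i.
  exact: (joint_rel_xw f sW2 n M f1 w1 t (i, t) _ _ _ _
    (source_rel_center f f_density f_var) (noise_rel_id sW2 sW2_gt0)).
rewrite mulr0 big1_eq in hxw.
have hw : Jrel (fun x y => (\sum_(i < M) noise n M x y (i, t)) ^+ 2) (M%:R * sW2).
  rewrite -[in M%:R](card_ord M); apply: joint_rel_sqr_sum => i k.
  case: eqVneq => [->|ki].
    exact: (joint_rel_sqr_w id sW2 (i, t) (noise_rel_sqr sW2 sW2_gt0)).
  apply: (joint_rel_ww f sW2 n M f1 w1 (i, t) (k, t) id) => //.
    by apply: contra ki => /eqP[->].
  exact: noise_rel_id.
have h := joint_relD f sW2 n M _ _ _ _ (joint_relZ f sW2 n M (c ^+ 2) _ _ hx)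
  (joint_relD f sW2 n M _ _ _ _ (joint_relZ f sW2 n M (- (2 * c * g)) _ _ hxw)
    (joint_relZ f sW2 n M (g ^+ 2) _ _ hw)).
rewrite mulr0 add0r in h.
apply: joint_rel_ext h _ => x y.
rewrite -mulr_sumr /lin_err.
have -> : \sum_(i < M) (tnth (tnth y i) t - m) =
    \sum_(i < M) noise n M x y (i, t) + M%:R * (tnth x t - m).
  rewrite mulr_natl -[in X in _ + X](card_ord M) -sumr_const -big_split /=.
  by apply: eq_bigr => i _; rewrite /noise /=; ring.
by rewrite /c -/m; ring.
Qed.

End Moments.

(** * Distortion of the coding scheme *)

Section Scheme.
Context {R : realType}.
Variables (dl u g m : R) (S n M : nat).

Definition decode (c : 'I_M -> nat) : n.-tuple R :=
  if [forall i, (c i < size (book S n))%N] then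
    [tuple m + g * \sum_(i < M)
       (cell_mid dl u S (nth [ffun=> ord0] (book S n) (c i) t) - m) | t < n]
  else [tuple 0 | t < n].

Definition reconstruct (y : M.-tuple (n.-tuple R)) : n.-tuple R :=
  decode (fun i => encode dl u S n (tnth y i)).

Lemma reconstruct_good (y : M.-tuple (n.-tuple R)) (t : 'I_n) :
  (forall i, small_word S n (word dl u S n (tnth y i))) ->
  tnth (reconstruct y) t = m + g * \sum_(i < M)
    (tnth (tnth y i) t + quant_err dl u (tnth (tnth y i) t) - m).
Proof.
move=> good; rewrite /reconstruct /decode.
have -> : [forall i, (encode dl u S n (tnth y i) < size (book S n))%N].
  by apply/forallP => i; rewrite index_mem mem_book.
rewrite tnth_mktuple; congr (m + g * _); apply: eq_bigr => i _; congr (_ - _).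
rewrite nth_index ?mem_book// ffunE cell_midE//.
by have := small_word_neq0 _ _ _ t (good i); rewrite ffunE.
Qed.

Lemma reconstruct_bad (y : M.-tuple (n.-tuple R)) (t : 'I_n) (i : 'I_M) :
  ~~ small_word S n (word dl u S n (tnth y i)) -> tnth (reconstruct y) t = 0.
Proof.
move=> bad; rewrite /reconstruct /decode ifF ?tnth_mktuple//.
apply/negbTE; rewrite negb_forall; apply/existsP; exists i.
by rewrite index_mem mem_book.
Qed.

End Scheme.

Section Distortion.
Context {R : realType}.
Variables (f : R -> R) (sW2 : R) (M : nat).
Hypothesis f_density : is_density f.
Hypothesis f_var : finite_variance f.
Hypothesis sW2_gt0 : 0 < sW2.

Let m := meanX f.

Lemma joint_pdf_ge0 n (x : n.-tuple R) (y : M.-tuple (n.-tuple R)) :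
  0 <= joint_pdf f sW2 n M x y.
Proof.
apply: mulr_ge0; first by apply: prodr_ge0 => t _; case: f_density => _ [].
by apply: prodr_ge0 => i _; apply: prodr_ge0 => t _; exact: noise_pdf_ge0.
Qed.

(** Chebyshev majorant of [T] times the overload indicator: the centred sums of an overloaded
    encoder add up to at least [n], whereas the mean of the whole is of order [1 / n]. *)
Definition overload_bound (T : R) (p q : R -> R) n (x : n.-tuple R)
    (y : M.-tuple (n.-tuple R)) : R :=
  T * \sum_(i < M) ((n%:R ^+ 2)^-1 * (2 * (\sum_(t < n) p (tnth x t)) ^+ 2 +
    2 * (\sum_(t < n) q (noise n M x y (i, t))) ^+ 2)).

(** Without overload the first term is the exact error. With overload the decoder answers 0, and the
    other two terms dominate the mean of the [x_t ^+ 2]. *)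
Lemma sqerr_reconstruct (dl u g T mu c : R) (p q : R -> R) (s n : nat)
    (x : n.-tuple R) (y : M.-tuple (n.-tuple R)) :
  0 < dl -> 0 <= u -> u <= 1 -> 0 <= T -> (0 < n)%N ->
  (forall z, `|z| <= p z + mu) -> (forall w, `|w| <= q w + c) ->
  mu + c + 1 <= dl * (s%:R - 2) ->
  sqerr n x (reconstruct dl u g m (n * s) n M y) <=
    n%:R^-1 * \sum_(t < n) (lin_err n M g m x y t -
        g * \sum_(i < M) quant_err dl u (tnth (tnth y i) t)) ^+ 2 +
    n%:R^-1 * \sum_(t < n) tail_sqr T (tnth x t) + overload_bound T p q n x y.
Proof.
move=> d0 u0 u1 T0 n0 hp hq hs; rewrite /sqerr.
have n0' : (0 : R) < n%:R by rewrite ltr0n.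
have tail0 z : 0 <= tail_sqr T z by rewrite /tail_sqr; case: ifP => // _; exact: sqr_ge0.
have term0 i : 0 <= (n%:R ^+ 2)^-1 * (2 * (\sum_(t < n) p (tnth x t)) ^+ 2 +
    2 * (\sum_(t < n) q (noise n M x y (i, t))) ^+ 2).
  by rewrite mulr_ge0 ?invr_ge0 ?sqr_ge0// addr_ge0// mulr_ge0 ?sqr_ge0.
have over0 : 0 <= overload_bound T p q n x y by rewrite mulr_ge0// sumr_ge0.
have tails0 : 0 <= n%:R^-1 * \sum_(t < n) tail_sqr T (tnth x t).
  by rewrite mulr_ge0 ?invr_ge0 ?(ltW n0')// sumr_ge0.
have [/forallP good|] := boolP [forall i, small_word (n * s) n (word dl u (n * s) n (tnth y i))].
  rewrite -addrA ler_wpDr ?addr_ge0// le_eqVlt; apply/orP; left; apply/eqP.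
  congr (_ * _); apply: eq_bigr => t _; rewrite reconstruct_good// /lin_err.
  have -> : \sum_(i < M) (tnth (tnth y i) t + quant_err dl u (tnth (tnth y i) t) - m) =
    \sum_(i < M) (tnth (tnth y i) t - m) + \sum_(i < M) quant_err dl u (tnth (tnth y i) t).
    by rewrite -big_split /=; apply: eq_bigr => i _; ring.
  by congr (_ ^+ 2); ring.
rewrite negb_forall => /existsP[i bad].
have over1 : T <= overload_bound T p q n x y.
  rewrite /overload_bound -[X in X <= _]mulr1 ler_wpM2l//.
  rewrite (bigD1 i)//= ler_wpDr ?sumr_ge0// mulrC ler_pdivlMr ?exprn_gt0// mul1r.
  set P := \sum_(t < n) p (tnth x t); set Q := \sum_(t < n) q (noise n M x y (i, t)).
  (* Then [n ^+ 2 <= (P + Q) ^+ 2 <= 2 * P ^+ 2 + 2 * Q ^+ 2]. The margin 1 per letter in the choice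
     of [s] provides [n <= P + Q]. *)
  suff nPQ : n%:R <= P + Q.
    have : n%:R ^+ 2 <= (P + Q) ^+ 2 by rewrite ler_pXn2r// nnegrE ltW// (lt_le_trans n0').
    have := sqr_ge0 (P - Q); rewrite !expr2; lra.
  have h := small_word_overload _ _ _ _ _ d0 u0 u1 bad.
  have {}h : n%:R * (mu + c + 1) <= \sum_(t < n) `|tnth (tnth y i) t|.
    apply: le_trans h; rewrite natrM mulrC.
    rewrite (_ : dl * (n%:R * s%:R - 2 * n%:R) = (dl * (s%:R - 2)) * n%:R); last by ring.
    by rewrite ler_wpM2r ?(ltW n0').
  have {}h : n%:R * (mu + c + 1) <= P + Q + n%:R * (mu + c).
    apply: le_trans h _; rewrite mulr_natl -[X in _ *+ X](card_ord n) -sumr_const.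
    rewrite /P /Q -!big_split /=; apply: ler_sum => t _.
    have := hp (tnth x t); have := hq (noise n M x y (i, t)).
    have := ler_normD (tnth x t) (noise n M x y (i, t)).
    rewrite (_ : tnth x t + noise n M x y (i, t) = tnth (tnth y i) t); last first.
      by rewrite /noise /=; ring.
    by move=> *; lra.
  by lra.
apply: (@le_trans _ _ (n%:R^-1 * \sum_(t < n) tail_sqr T (tnth x t) + T)); last first.
  rewrite -addrA ler_wpDl ?lerD2l//.
  by rewrite mulr_ge0 ?invr_ge0 ?(ltW n0')// sumr_ge0// => t _; exact: sqr_ge0.
rewrite [X in _ <= _ + X](_ : T = n%:R^-1 * \sum_(t < n) T); last first.
  by rewrite sumr_const card_ord -[T *+ n]mulr_natl mulKf ?gt_eqF.
rewrite -mulrDr ler_wpM2l ?invr_ge0 ?(ltW n0')// -big_split /=.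
apply: ler_sum => t _; rewrite (reconstruct_bad _ _ _ _ _ _ _ _ _ i)// subr0 /tail_sqr.
by case: (ltP T (tnth x t ^+ 2)) => h; lra.
Qed.

(** The cross term is at most [(z ^+ 2 + 1) * dl] in total, and [1 <= L * dl] turns this into
    [(z ^+ 2 + 1) * dl ^+ 2] per dither. *)
Lemma sum_sqr_dither (L : nat) (z dl : R) (e : 'I_L -> R) :
  0 < dl -> 1 <= L%:R * dl -> `|\sum_j e j| <= dl -> (forall j, `|e j| <= dl) ->
  \sum_(j < L) (z - e j) ^+ 2 <= L%:R * ((1 + dl ^+ 2) * z ^+ 2 + 2 * dl ^+ 2).
Proof.
move=> d0 Ld se he.
have -> : \sum_(j < L) (z - e j) ^+ 2 =
    L%:R * z ^+ 2 - 2 * z * \sum_j e j + \sum_j e j ^+ 2.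
  rewrite mulr_natl -[X in _ *+ X](card_ord L) -sumr_const mulr_sumr -sumrB -big_split /=.
  by apply: eq_bigr => j _; ring.
have s2 : \sum_j e j ^+ 2 <= L%:R * dl ^+ 2.
  rewrite mulr_natl -[X in _ *+ X](card_ord L) -sumr_const; apply: ler_sum => j _.
  by rewrite -real_normK ?num_real// ler_pXn2r// nnegrE ltW.
have cross : - (2 * z * \sum_j e j) <= (z ^+ 2 + 1) * dl.
  apply: le_trans (ler_norm _) _; rewrite normrN !normrM.
  apply: (@le_trans _ _ (`|2| * `|z| * dl)).
    by rewrite ler_wpM2l// mulr_ge0.
  rewrite ler_wpM2r ?(ltW d0)// ger0_norm// -[z ^+ 2]real_normK ?num_real//.
  by have := sqr_ge0 (`|z| - 1); rewrite sqrrB; lra.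
have dL : dl <= L%:R * dl ^+ 2.
  by rewrite expr2 mulrA ler_peMl// ltW.
have := ler_wpM2l (_ : 0 <= z ^+ 2 + 1) dL => /(_ (addr_ge0 (sqr_ge0 z) ler01)).
lra.
Qed.

End Distortion.

(** * Averaging over the dithers *)

Section Achievability.
Context {R : realType}.
Variables (f : R -> R) (sW2 : R) (M : nat).
Hypothesis f_density : is_density f.
Hypothesis f_var : finite_variance f.
Hypothesis sW2_gt0 : 0 < sW2.

Lemma exists_dither (g dl T mu c v Vp Vq : R) (p q : R -> R) (s n L : nat) :
  0 <= g -> g * M%:R <= 1 -> 0 < dl -> (0 < L)%N -> 1 <= L%:R * dl ->
  0 <= T -> (0 < n)%N ->
  (forall z, `|z| <= p z + mu) -> (forall w, `|w| <= q w + c) ->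
  mu + c + 1 <= dl * (s%:R - 2) ->
  source_rel f (tail_sqr T) v ->
  source_rel f p 0 -> source_rel f (fun x => p x ^+ 2) Vp ->
  noise_rel sW2 q 0 -> noise_rel sW2 (fun w => q w ^+ 2) Vq ->
  exists j : 'I_L,
    (exp_dist f sW2 n M (reconstruct dl (j%:R / L%:R) g (meanX f) (n * s) n M) <=
    ((1 + dl ^+ 2) * ((1 - g * M%:R) ^+ 2 * varX f + g ^+ 2 * (M%:R * sW2)) +
      2 * dl ^+ 2 + v + T * M%:R * (2 * Vp + 2 * Vq) / n%:R)%:E)%E.
Proof.
move=> g0 gM d0 L0 Ld T0 n0 hp hq hs hv hp0 hp2 hq0 hq2.
set D := (1 - g * M%:R) ^+ 2 * varX f + _; set m := meanX f.
set val := (X in (X%:E)%E).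
have n0' : (0 : R) < n%:R by rewrite ltr0n.
have L0' : (0 : R) < L%:R by rewrite ltr0n.
have f1 := source_rel1 f f_density; have w1 := noise_rel1 sW2 sW2_gt0.
(* [B] majorizes the average over the dithers of the squared error, and is built from functions
   whose mean is known. *)
pose B x y := n%:R^-1 * \sum_(t < n) ((1 + dl ^+ 2) * lin_err n M g m x y t ^+ 2 + 2 * dl ^+ 2)
  + n%:R^-1 * \sum_(t < n) tail_sqr T (tnth x t) + overload_bound M T p q n x y.
have JB : joint_rel f sW2 n M B val.
  have h1 := joint_relZ f sW2 n M n%:R^-1 _ _ (joint_rel_sum f sW2 n M f_density sW2_gt0 _
    (index_enum 'I_n) _ _ (fun t => joint_relD f sW2 n M _ _ _ _
    (joint_relZ f sW2 n M (1 + dl ^+ 2) _ _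
      (joint_rel_lin_err f sW2 n M f_density f_var sW2_gt0 g t))
    (joint_rel_cst f sW2 n M f_density sW2_gt0 (2 * dl ^+ 2)))).
  have h2 := joint_relZ f sW2 n M n%:R^-1 _ _ (joint_rel_sum f sW2 n M f_density sW2_gt0 _
    (index_enum 'I_n) _ _ (fun t => joint_rel_x f sW2 n M f1 w1 t _ _ hv)).
  have h3 := joint_relZ f sW2 n M T _ _ (joint_rel_sum f sW2 n M f_density sW2_gt0 _
    (index_enum 'I_M) _ _ (fun i => joint_relZ f sW2 n M (n%:R ^+ 2)^-1 _ _
      (joint_relD f sW2 n M _ _ _ _
        (joint_relZ f sW2 n M 2 _ _
          (joint_rel_sqr_sum_x f sW2 n M f_density sW2_gt0 p Vp hp0 hp2))
        (joint_relZ f sW2 n M 2 _ _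
          (joint_rel_sqr_sum_w f sW2 n M f_density sW2_gt0 q Vq i hq0 hq2))))).
  have h := joint_relD f sW2 n M _ _ _ _ (joint_relD f sW2 n M _ _ _ _ h1 h2) h3.
  rewrite !sumr_const !card_ord -/D in h.
  suff -> : val = n%:R^-1 * (((1 + dl ^+ 2) * D + 2 * dl ^+ 2) *+ n) + n%:R^-1 * (v *+ n) +
    T * (((n%:R ^+ 2)^-1 * (2 * (n%:R * Vp) + 2 * (n%:R * Vq))) *+ M) by exact: h.
  rewrite -[_ *+ n]mulr_natl -[v *+ n]mulr_natl -[_ *+ M]mulr_natl /val.
  by field; rewrite gt_eqF.
pose rc (j : 'I_L) := reconstruct dl (j%:R / L%:R) g m (n * s) n M.
(* The comparison is pointwise, since the dithers cancel at every value of the observations. *)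
have pt x y : \sum_(j < L) sqerr n x (rc j y) <= L%:R * B x y.
  have u01 (j : 'I_L) : 0 <= (j%:R / L%:R : R) /\ (j%:R / L%:R : R) <= 1.
    split; first by rewrite divr_ge0// ltW.
    by rewrite ler_pdivrMr// mul1r ler_nat ltnW.
  apply: (@le_trans _ _ (\sum_(j < L)
    (n%:R^-1 * \sum_(t < n) (lin_err n M g m x y t -
        g * \sum_(i < M) quant_err dl (j%:R / L%:R) (tnth (tnth y i) t)) ^+ 2 +
    n%:R^-1 * \sum_(t < n) tail_sqr T (tnth x t) + overload_bound M T p q n x y))).
    apply: ler_sum => j _; have [? ?] := u01 j.
    exact: (sqerr_reconstruct f M dl _ g T mu c).
  under eq_bigr do rewrite -addrA.
  rewrite big_split /= sumr_const card_ord -[X in _ + X <= _]mulr_natl /B.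
  rewrite -[X in _ <= _ * X]addrA [X in _ <= X]mulrDr lerD2r -mulr_sumr mulrCA ler_wpM2l ?invr_ge0 ?(ltW n0')//.
  rewrite exchange_big /= mulr_sumr; apply: ler_sum => t _.
  apply: sum_sqr_dither => //.
    (* Because [g * M <= 1], the weighted errors of the [M] encoders obey the bound [dl] of a single
       one. *)
    rewrite -mulr_sumr exchange_big /= normrM ger0_norm//.
    apply: (@le_trans _ _ (g * \sum_(i < M) dl)).
      rewrite ler_wpM2l//; apply: le_trans (ler_norm_sum _ _ _) _.
      by apply: ler_sum => i _; exact: quant_err_sum.
    by rewrite sumr_const card_ord -[dl *+ M]mulr_natl mulrA ler_piMl// ltW.
  move=> j; rewrite normrM ger0_norm//.
  apply: (@le_trans _ _ (g * \sum_(i < M) dl)).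
    rewrite ler_wpM2l//; apply: le_trans (ler_norm_sum _ _ _) _.
    by apply: ler_sum => i _; exact: quant_err_le.
  by rewrite sumr_const card_ord -[dl *+ M]mulr_natl mulrA ler_piMl// ltW.
have pdf0 := joint_pdf_ge0 f sW2 M f_density n.
have sq0 x y j : 0 <= sqerr n x (rc j y).
  by rewrite mulr_ge0 ?invr_ge0 ?(ltW n0')// sumr_ge0// => t _; exact: sqr_ge0.
have total : (\sum_(j < L) exp_dist f sW2 n M (rc j) <= (L%:R * val)%:E)%E.
  rewrite -(joint_rel_val f sW2 n M _ _ (joint_relZ f sW2 n M L%:R _ _ JB)).
  apply: le_trans (joint_int_sum n M _ _
    (fun (j : 'I_L) x y => (joint_pdf f sW2 n M x y * sqerr n x (rc j y))%:E) _) _.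
    by move=> j x y; rewrite lee_fin mulr_ge0.
  apply: joint_int_le => x y.
    by apply: sume_ge0 => j _; rewrite lee_fin mulr_ge0.
  by rewrite sumEFin lee_fin -mulr_sumr ler_wpM2l.
(* If every dither exceeded [val], the sum would exceed [L * val]. *)
apply: contrapT => none.
have gt j : (val%:E < exp_dist f sW2 n M (rc j))%E.
  by rewrite ltNge; apply/negP => le; apply: none; exists j.
have : (\sum_(j < L) val%:E < \sum_(j < L) exp_dist f sW2 n M (rc j))%E.
  case: L L0 rc gt {Ld L0' pt sq0 total none} => // L _ rc gt.
  elim: L rc gt => [|L IH] rc gt; first by rewrite !big_ord1.
  rewrite !(big_ord_recr L.+1) /=; apply: lteD => //.
  exact: (IH (fun j => rc (widen_ord (leqnSn _) j))).
rewrite sumEFin sumr_const card_ord -[val *+ L]mulr_natl => /lt_le_trans /(_ total).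
by rewrite ltxx.
Qed.

End Achievability.

(** * Rates *)

Section RateLoss.
Context {R : realType}.
Variables (f : R -> R) (sW2 : R) (M : nat).
Hypothesis f_density : is_density f.
Hypothesis f_var : finite_variance f.
Hypothesis var_gt0 : 0 < varX f.
Hypothesis sW2_gt0 : 0 < sW2.

Lemma D_N0_ge0 : 0 <= D_N0 f sW2 M.
Proof.
have v0 := ltW var_gt0; have s0 := ltW sW2_gt0.
by rewrite /D_N0 divr_ge0 ?addr_ge0 ?mulr_ge0.
Qed.

(** An encoder outputs at least one index, so [1 <= expR (n * r)]; a positive block length, here
    [N.+1], then forces [0 <= r]. *)
Lemma R_R_ge0 (D : R) : (0 <= R_R f sW2 M D)%E.
Proof.
apply: le_ereal_inf_tmp => _ [r hr <-]; rewrite lee_fin.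
have [N hN] := hr 1 ltr01.
have [enc [dec [_ [henc _]]]] := hN N.+1 (leqnSn N).
have := leq_ltn_trans (leq0n _) (henc [tuple [tuple 0 | t < N.+1] | i < M]).
rewrite /nidx Num.Theory.truncn_gt0 -[X in X <= _]expR0 ler_expR.
by rewrite pmulr_rge0.
Qed.

Lemma CEO_achievable_high_resolution : exists C : R, forall dl : R,
  0 < dl -> dl <= 1 ->
  CEO_achievable f sW2 M (D_N0 f sW2 M + (D_N0 f sW2 M + 2) * dl ^+ 2)
    (fun=> C + ln (8 / dl)).
Proof.
have [mu [Vp [hp0 hp2 mu0]]] := source_rel_abs f f_density f_var.
have [hq0 [Vq hq2]] := noise_rel_cosh2_center R sW2 sW2_gt0.
set q := (fun w => cosh2 w - _) in hq0 hq2.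
set c := 2 * expR (sW2 / 2) in q hq0 hq2.
have c0 : 0 < c by rewrite mulr_gt0// expR_gt0.
(* The budget [dl * s] must exceed [mu + c + 1] by [2 * dl], and rounding [s] up costs at most
   another [dl]; as [dl <= 1], 4 suffices for all [dl]. *)
exists (mu + c + 4) => dl d0 d1 e e0.
have e20 : 0 < e / 2 by rewrite divr_gt0.
have [T [v [T0 ve hv]]] := source_rel_tail f f_density f_var _ e20.
pose L := (Num.truncn dl^-1).+1.
have Ld : 1 <= L%:R * dl.
  rewrite -ler_pdivrMr// mul1r.
  have id0 : 0 <= dl^-1 by rewrite invr_ge0 ltW.
  by have /andP[_ /ltW] := Num.Theory.truncn_itv id0.
pose s := (Num.truncn ((mu + c + 1) / dl)).+3.
have K0 : 0 <= (mu + c + 1) / dl by rewrite divr_ge0 ?(ltW d0)//; lra.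
have /andP[s1 s2] := Num.Theory.truncn_itv K0.
rewrite -natr1 in s2.
have sE : s%:R = (Num.truncn ((mu + c + 1) / dl))%:R + 3 :> R.
  by rewrite /s -addn3 natrD.
have slow : mu + c + 1 <= dl * (s%:R - 2).
  by rewrite mulrC -ler_pdivrMr// sE; lra.
have sup : dl * s%:R <= mu + c + 4.
  by move: s1; rewrite ler_pdivlMr// sE => ?; lra.
(* Half of [e] went to the tail, which fixed [T]; the other half bounds the Chebyshev term [W / n]
   for large [n]. *)
pose W := T * M%:R * (2 * Vp + 2 * Vq).
pose N := (Num.truncn (`|W| / (e / 2))).+1.
exists N => n Nn.
have n0 : (0 < n)%N by exact: leq_trans Nn.
have n0' : (0 : R) < n%:R by rewrite ltr0n.
have We : W / n%:R <= e / 2.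
  have h0 : 0 <= `|W| / (e / 2) by rewrite divr_ge0// ltW.
  have /andP[_ /ltW h1] := Num.Theory.truncn_itv h0.
  have {h1} : `|W| / (e / 2) <= n%:R by apply: le_trans h1 _; rewrite ler_nat.
  rewrite ler_pdivrMr// => h1; rewrite ler_pdivrMr// mulrC.
  exact: le_trans (ler_norm W) h1.
(* The gain of the optimal linear estimator, whose mean squared error is [D_N0]. *)
pose g := varX f / (M%:R * varX f + sW2).
have den0 : 0 < M%:R * varX f + sW2.
  by rewrite ltr_wpDl// mulr_ge0// ltW.
have g0 : 0 <= g by rewrite divr_ge0// ltW.
have gM : g * M%:R <= 1.
  by rewrite /g mulrAC ler_pdivrMr// mul1r mulrC lerDl ltW.
have DE : (1 - g * M%:R) ^+ 2 * varX f + g ^+ 2 * (M%:R * sW2) = D_N0 f sW2 M.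
  by rewrite /g /D_N0; field; rewrite gt_eqF.
have hp (z : R) : `|z| <= (`|z| - mu) + mu by rewrite subrK.
have hq w : `|w| <= q w + c by rewrite subrK ler_norm_cosh2.
have [j hj] := exists_dither f sW2 M f_density f_var sW2_gt0 g dl T mu c v Vp Vq
  _ q s n L g0 gM d0 (ltn0Sn _) Ld T0 n0 hp hq slow hv hp0 hp2 hq0 hq2.
exists (fun=> encode dl (j%:R / L%:R) (n * s) n), (decode dl (j%:R / L%:R) g (meanX f) (n * s) n M).
split; first by move=> _; exact: measurable_encode.
split; first by move=> _ y; exact: encode_lt_nidx.
apply: le_trans hj _; rewrite lee_fin DE -/W.
lra.
Qed.

Lemma rate_loss_le : exists C : R, forall d : R, 0 < d -> d <= 1 ->
  (rate_loss f sW2 M (D_N0 f sW2 M + d) <= (M%:R / 2 * ln d^-1 + C)%:E)%E.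
Proof.
have [C hC] := CEO_achievable_high_resolution.
set D := D_N0 f sW2 M in hC *; have D0 : 0 <= D := D_N0_ge0.
have D2 : 0 < D + 2 by lra.
exists (M%:R * (C + ln 8 + ln (D + 2) / 2)) => d d0 d1.
(* The step solves [(D + 2) * dl ^+ 2 = d], so each encoder's rate contains half of [ln d^-1]. *)
pose dl := expR (- ((ln d^-1 + ln (D + 2)) / 2)).
have dl2 : (D + 2) * dl ^+ 2 = d.
  rewrite /dl -expRM_natl mulrN [2 * _]mulrC divfK// expRN expRD !lnK ?posrE ?invr_gt0//.
  by rewrite invfM invrK mulrCA mulfV ?mulr1// gt_eqF.
have dl1 : dl <= 1.
  rewrite /dl -[X in _ <= X]expR0 ler_expR oppr_le0 divr_ge0// addr_ge0// ln_ge0//.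
    by rewrite invf_ge1.
  lra.
have h := hC dl (expR_gt0 _) dl1; rewrite dl2 in h.
have l8 : ln (8 / dl) = ln 8 + (ln d^-1 + ln (D + 2)) / 2.
  by rewrite lnM ?posrE ?invr_gt0 ?expR_gt0// lnV ?posrE ?expR_gt0// expRK opprK.
apply: (@le_trans _ _ (R_CEO f sW2 M (D + d))).
  rewrite /rate_loss -[leRHS]sube0; apply: leeB => //; exact: R_R_ge0.
apply: ereal_inf_lbound; exists (fun=> C + ln (8 / dl)) => //.
rewrite sumr_const card_ord -[_ *+ M]mulr_natl l8; by congr (_%:E); field.
Qed.

End RateLoss.

(** * The limit of the ratio and the conclusion *)

Lemma cvg_affine_ln_ratio (R : realType) (k C : R) : 0 < k ->
  (fun d : R => (k * ln d^-1 + C) / (k * ln d^-1)) @ 0^'+ --> (1 : R).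
Proof.
move=> k0; apply/cvgrPdist_lt => e e0.
near=> d.
have d0 : 0 < d by near: d; exact: nbhs_right_gt.
(* Below this threshold [ln d^-1] exceeds [|C| / (k * e)], which makes the deviation
   [C / (k * ln d^-1)] smaller than [e]. *)
have : d < expR (- (`|C| / (k * e) + 1)) by near: d; apply: nbhs_right_lt; exact: expR_gt0.
rewrite -{1}[d]lnK ?posrE// ltr_expR => h.
have CK : 0 <= `|C| / (k * e) by rewrite divr_ge0// mulr_ge0// ltW.
have lE : ln d^-1 = - ln d by rewrite lnV ?posrE.
have l0 : `|C| / (k * e) < ln d^-1 by rewrite lE; lra.
have l1 : 0 < ln d^-1 by exact: le_lt_trans l0.
have -> : 1 - (k * ln d^-1 + C) / (k * ln d^-1) = - (C / (k * ln d^-1)).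
  by field; rewrite !gt_eqF.
rewrite normrN normrM normfV (gtr0_norm (mulr_gt0 k0 l1)).
rewrite ltr_pdivrMr ?mulr_gt0//; move: l0; rewrite ltr_pdivrMr ?mulr_gt0//.
by congr (_ < _); ring.
Unshelve. all: by end_near. Qed.

Theorem theorem5 (R : realType) (f : R -> R) (sW2 : R) (M : nat) :
  is_density f -> finite_variance f -> (0 < varX f) -> finite_entropy f ->
  (0 < sW2) -> (2 <= M)%N ->
  exists g : R -> R,
    (\forall d \near 0^'+,
        (rate_loss f sW2 M (D_N0 f sW2 M + d) <= (g d)%:E)%E) /\
    ((fun d => g d / ((M%:R / 2) * ln (d^-1))) @ 0^'+ --> (1 : R)).
Proof.
move=> f_density f_var var_gt0 _ sW2_gt0 M2.
have [C hC] := rate_loss_le f sW2 M f_density f_var var_gt0 sW2_gt0.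
exists (fun d => M%:R / 2 * ln d^-1 + C); split.
  near=> d; apply: hC; first by near: d; exact: nbhs_right_gt.
  by near: d; apply: nbhs_right_le; exact: ltr01.
apply: cvg_affine_ln_ratio.
by rewrite divr_gt0// ltr0n (leq_trans _ M2).
Unshelve. all: by end_near. Qed.
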